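(* Let $N>1$ and $G=\mathrm{U}(N)\rtimes\langle\tau\rangle$, where $\tau^2=I$ and $\tau X\tau^{-1}=\overline{X}$ for all $X\in\mathrm{U}(N)$. Let $K$ be a connected semisimple (closed) subgroup of $\mathrm{U}(N)$ containing $-I$, let $\rho$ be the restriction to $K$ of the natural representation $\mathbb{C}^N$ of $\mathrm{U}(N)$, and let $\theta_1,\theta_2$ be two outer involutive automorphisms of $K$ such that: (i) $\rho$ is irreducible and non-self dual; (ii) $\theta_1^{*}\rho\cong\theta_2^{*}\rho\cong\rho^{*}$; (iii) the images of $\theta_1$ and $\theta_2$ in $\mathrm{Out}(K)=\mathrm{Aut}(K)/\mathrm{Int}(K)$ are non-conjugate. For $i=1,2$ let $H_i$ be a subgroup of $G$ generated by $K$ and an element $g_i\in\mathrm{U}(N)\tau$ such that $g_i^2=\pm I$ and $\mathrm{Ad}(g_i)|_K=\theta_i$ (such subgroups exist). Put $H_3=\langle H_1,Z(\mathrm{U}(N))\rangle$ and $H_4=\langle H_2,Z(\mathrm{U}(N))\rangle$. Then each $H_i$ ($i=1,2,3,4$) is an $S$-subgroup of $G$, the groups $H_1,H_2,H_3,H_4$ are pairwise non-isomorphic, and $$(\mathscr{D}_{H_1}-\mathscr{D}_{H_2})-(\mathscr{D}_{H_3}-\mathscr{D}_{H_4})=0.$$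
   Context: Dimension datum: for a closed subgroup $H$ of a compact Lie group $G$, $\mathscr{D}_H$ is the function on the set of isomorphism classes of irreducible finite-dimensional complex linear representations $\sigma$ of $G$ given by $\mathscr{D}_H(\sigma)=\dim\sigma^H$. $S$-subgroup: let $G$ be a compact Lie group with cyclic component group $G/G^0$, $g_0\in G$ an element generating $G/G^0$, $\mathfrak{g}$ the complexified Lie algebra of $G$, and $e$ the order of the class of $\mathrm{Ad}(g_0)|_{\mathfrak{g}}$ in $\mathrm{Out}(\mathfrak{g})=\mathrm{Aut}(\mathfrak{g})/\mathrm{Int}(\mathfrak{g})$. A closed subgroup $H\subset G$ is an $S$-subgroup if $H$ is generated by $H^0$ and an element $h_0\in g_0G^0$ with $h_0^{e}\in Z_G(G^0)H^0$, and $Z_G(H)=Z(G)$. Here $\theta^*\rho=\rho\circ\theta$, $\rho^*$ is the dual representation, and $\mathrm{Ad}(g)$ denotes conjugation by $g$. *)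

(* Defs.v *)
From HB Require Import structures.
From mathcomp Require Import all_boot all_order all_algebra.
From mathcomp Require Import all_classical all_reals all_analysis.
From mathcomp Require Import complex spectral.
Set Implicit Arguments.
Unset Strict Implicit.
Unset Printing Implicit Defensive.
Import Order.TTheory GRing.Theory Num.Theory numFieldNormedType.Exports.
Local Open Scope classical_set_scope.
Local Open Scope ring_scope.

(* Compact Lie groups are realized as closed subgroups of U(n), i.e. as sets
   of matrices.  The definitions are stated over any [C : numClosedFieldType],
   because MathComp-Analysis attaches a topology to that structure and not to
   the type [R[i]] itself; they are used at [C := R[i]] with [R : realType].
   [t \is Num.real] then singles out the real scalars. *)

Section MatrixGroups.
Variable C : numClosedFieldType.

Section FixedSize.
Variable n : nat.
Implicit Types (A B G H : set 'M[C]_n) (f g : 'M[C]_n -> 'M[C]_n).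

Definition subgroup H : Prop :=
  [/\ H `<=` [set X | X \in unitmx],
      H 1%:M,
      forall X Y, H X -> H Y -> H (X *m Y)
    & forall X, H X -> H (invmx X)].

Definition closed_subgroup G H : Prop :=
  [/\ subgroup H, closed H & H `<=` G].

Definition generated A : set 'M[C]_n :=
  [set X | forall H, subgroup H -> A `<=` H -> H X].

Definition prodset A B : set 'M[C]_n := [set X *m Y | X in A & Y in B].

Definition centralizer A B : set 'M[C]_n :=
  [set X | A X /\ forall Y, B Y -> X *m Y = Y *m X].

Definition center G : set 'M[C]_n := centralizer G G.

Definition conjm (X Y : 'M[C]_n) : 'M[C]_n := X *m Y *m invmx X.

Definition idcomp H : set 'M[C]_n := connected_component H 1%:M.

(* Nonnegative powers suffice because the component group is finite. *)
Definition generates_components G (g0 : 'M[C]_n) : Prop :=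
  G g0 /\
  forall X, G X -> exists k : nat, prodset [set g0 ^+ k] (idcomp G) X.

(* Out(K) = Aut(K)/Int(K).  Automorphisms of K are maps on all matrices, of
   which only the values on K matter. *)
Definition inner H f : Prop :=
  exists2 k, H k & forall X, H X -> f X = conjm k X.

Definition same_outer_class H f g : Prop :=
  exists2 k, H k & forall X, H X -> f X = conjm k (g X).

End FixedSize.

Definition lie_morphism m n (H : set 'M[C]_m) (H' : set 'M[C]_n)
    (f : 'M[C]_m -> 'M[C]_n) : Prop :=
  [/\ forall X, H X -> H' (f X),
      forall X Y, H X -> H Y -> f (X *m Y) = f X *m f Y
    & {within H, continuous f}].

Definition lie_isomorphism m n (H : set 'M[C]_m) (H' : set 'M[C]_n)
    (f : 'M[C]_m -> 'M[C]_n) : Prop :=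
  lie_morphism H H' f /\
  exists f' : 'M[C]_n -> 'M[C]_m,
    [/\ lie_morphism H' H f',
        forall X, H X -> f' (f X) = X
      & forall Y, H' Y -> f (f' Y) = Y].

Definition isomorphic m n (H : set 'M[C]_m) (H' : set 'M[C]_n) : Prop :=
  exists f, lie_isomorphism H H' f.

Section Automorphisms.
Variable n : nat.
Implicit Types (H : set 'M[C]_n) (f g : 'M[C]_n -> 'M[C]_n).

Definition automorphism H f : Prop := lie_isomorphism H H f.

Definition outer_involution H f : Prop :=
  [/\ automorphism H f, forall X, H X -> f (f X) = X & ~ inner H f].

(* [p][f][p]^-1 = [g] in Out(H), written as [p][f] = [g][p]. *)
Definition conjugate_in_Out H f g : Prop :=
  exists2 p, automorphism H p & same_outer_class H (p \o f) (g \o p).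

End Automorphisms.

Section LieAlgebra.
Variable n : nat.
Implicit Types (G H : set 'M[C]_n) (L I : set 'M[C]_n) (X Y : 'M[C]_n).

Definition mexp X : 'M[C]_n :=
  limn (series (fun k : nat => (k`!)%:R^-1 *: X ^+ k)).

Definition lieb X Y : 'M[C]_n := X *m Y - Y *m X.

(* The value at Y of the endomorphism exp(ad X) *)
Definition exp_ad X Y : 'M[C]_n :=
  limn (series (fun k : nat => (k`!)%:R^-1 *: iter k (lieb X) Y)).

(* The (real) Lie algebra of a closed matrix group *)
Definition lie G : set 'M[C]_n :=
  [set X | forall t : C, t \is Num.real -> G (mexp (t *: X))].

(* The Lie algebra of a closed subgroup of U(n) consists of skew-Hermitian
   matrices, so it meets its multiple by 'i only in 0, and its
   complexification is the following complex subspace of 'M_n. *)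
Definition clie G : set 'M[C]_n := [set X + 'i *: Y | X in lie G & Y in lie G].

(* Int(g): the group generated by the exp(ad X), X in g; it contains inverses
   since exp(ad X)^-1 = exp(ad (- X)). *)
Definition Int_clie G (f : 'M[C]_n -> 'M[C]_n) : Prop :=
  exists2 s : seq 'M[C]_n, (forall X, X \in s -> clie G X) &
    forall Y, clie G Y -> f Y = foldr exp_ad Y s.

Definition Out_order G (g0 : 'M[C]_n) (e : nat) : Prop :=
  [/\ (0 < e)%N,
      Int_clie G (iter e (conjm g0))
    & forall k : nat, (0 < k < e)%N -> ~ Int_clie G (iter k (conjm g0))].

Definition S_subgroup G (g0 : 'M[C]_n) H : Prop :=
  [/\ closed_subgroup G H,
      exists e h0,
        [/\ Out_order G g0 e,
            prodset [set g0] (idcomp G) h0,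
            prodset (centralizer G (idcomp G)) (idcomp H) (h0 ^+ e)
          & H = generated (idcomp H `|` [set h0])]
    & centralizer G H = center G].

Definition real_subspace L : Prop :=
  [/\ L 0,
      forall X Y, L X -> L Y -> L (X + Y)
    & forall (t : C) X, t \is Num.real -> L X -> L (t *: X)].

Definition real_span (A : set 'M[C]_n) : set 'M[C]_n :=
  [set X | forall L, real_subspace L -> A `<=` L -> L X].

Definition derived L : set 'M[C]_n :=
  real_span [set lieb X Y | X in L & Y in L].

Definition lie_ideal L I : Prop :=
  [/\ real_subspace I, I `<=` L & forall X Y, L X -> I Y -> I (lieb X Y)].

Definition solvable_lie L : Prop :=
  exists k : nat, iter k derived L `<=` [set 0].

Definition semisimple_lie L : Prop :=
  forall I, lie_ideal L I -> solvable_lie I -> I `<=` [set 0].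

Definition connected_semisimple G : Prop :=
  connected G /\ semisimple_lie (lie G).

End LieAlgebra.

Section Representations.
Variable m : nat.
Implicit Types (G H : set 'M[C]_m).

(* A representation of G on C^n is a map on all matrices, of which only the
   restriction to G matters. *)
Definition representation G n (s : 'M[C]_m -> 'M[C]_n) : Prop :=
  [/\ s 1%:M = 1%:M,
      forall X Y, G X -> G Y -> s (X *m Y) = s X *m s Y
    & {within G, continuous s}].

Definition irreducible_rep G n (s : 'M[C]_m -> 'M[C]_n) : Prop :=
  [/\ representation G s,
      (0 < n)%N
    & forall W : {vspace 'cV[C]_n},
        (forall X v, G X -> v \in W -> s X *m v \in W) ->
        W = 0%VS \/ W = fullv].

Definition rep_iso G n (s s' : 'M[C]_m -> 'M[C]_n) : Prop :=
  exists2 A : 'M[C]_n, A \in unitmx &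
    forall X, G X -> A *m s X = s' X *m A.

Definition dual_rep n (s : 'M[C]_m -> 'M[C]_n) : 'M[C]_m -> 'M[C]_n :=
  fun X => (s (invmx X))^T.

(* dim s^H, as the largest number of linearly independent H-fixed vectors
   (the columns of V) *)
Definition dimension_datum H n (s : 'M[C]_m -> 'M[C]_n) : nat :=
  \max_(d < n.+1 | `[< exists2 V : 'M[C]_(n, d), \rank V = d &
                         forall X, H X -> s X *m V = V >]) d.

End Representations.

(* U(N) ><| <tau> is realized inside U(2N): X in U(N) corresponds to
   diag(X, conj X), and tau to the matrix exchanging the two blocks. *)
Section UnitaryExtension.
Variable N : nat.

Definition U : set 'M[C]_N := [set X | X \is unitarymx].

Definition iota (X : 'M[C]_N) : 'M[C]_(N + N) :=
  block_mx X 0 0 (map_mx Num.conj X).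

Definition tau : 'M[C]_(N + N) := block_mx 0 1%:M 1%:M 0.

Definition Utau : set 'M[C]_(N + N) := [set iota X *m tau | X in U].

Definition Uext : set 'M[C]_(N + N) := iota @` U `|` Utau.

Lemma iota_inj : injective iota.
Proof. by move=> X Y /eq_block_mx[]. Qed.

Lemma iotaM X Y : iota (X *m Y) = iota X *m iota Y.
Proof.
by rewrite /iota map_mxM mulmx_block !mulmx0 !mul0mx !addr0 !add0r.
Qed.

Lemma tau_sq : tau *m tau = 1%:M.
Proof.
by rewrite /tau mulmx_block !mulmx0 !mul0mx !mulmx1 !addr0 !add0r
           -scalar_mx_block.
Qed.

Lemma conj_tau X : conjm tau (iota X) = iota (map_mx Num.conj X).
Proof.
have tu : tau \in unitmx by have /mulmx1_unit[] := tau_sq.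
apply: (can_inj (mulmxK tu)); rewrite /conjm mulmxKV //.
rewrite /iota /tau !mulmx_block !mulmx0 !mul0mx !mulmx1 !mul1mx !addr0 !add0r.
by congr block_mx; apply/matrixP => i j; rewrite !mxE conjCK.
Qed.

Definition lifts (K : set 'M[C]_N) (theta : 'M[C]_N -> 'M[C]_N)
    (g : 'M[C]_(N + N)) : Prop :=
  [/\ Utau g,
      g *m g = 1%:M \/ g *m g = - 1%:M
    & forall X, K X -> conjm g (iota X) = iota (theta X)].

Definition extension (K : set 'M[C]_N) (g : 'M[C]_(N + N)) :
    set 'M[C]_(N + N) :=
  generated (iota @` K `|` [set g]).

Definition adjoin_center (H : set 'M[C]_(N + N)) : set 'M[C]_(N + N) :=
  generated (H `|` iota @` center U).

End UnitaryExtension.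

End MatrixGroups.
Arguments U {C} N.
Arguments Uext {C} N.

(* Main.v *)
Require Import Defs.
From HB Require Import structures.
From mathcomp Require Import all_boot all_order all_algebra.
From mathcomp Require Import all_classical all_reals all_analysis.
From mathcomp Require Import complex spectral ring lra.
Set Implicit Arguments.
Unset Strict Implicit.
Unset Printing Implicit Defensive.
Import Order.TTheory GRing.Theory Num.Theory numFieldNormedType.Exports.
Local Open Scope classical_set_scope.
Local Open Scope ring_scope.

(** Why the theorem is true.

    Let T be the group of unit scalars, KT the group generated by K and T, and
    g1, g2 the two lifts.  Since g_i normalizes K and g_i^2 = +-I lies in K,
    H_1 = K u K g1 and H_2 = K u K g2; since g z = conj z g for z in T, also
    H_3 = KT u KT g1 and H_4 = KT u KT g2.  Their identity components are K, K,
    KT and KT.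

    Lifts.  A matrix A intertwining theta^* rho with rho^* satisfies
    A theta(X) = conj(X) A; by Schur's lemma A is a multiple of a unitary
    matrix B, and g = B^-1 tau is the lift: its square commutes with K, so it is
    a scalar d, and d is real because g commutes with g^2 (lifts_exist).

    S-subgroups.  An element of U(N) commuting with H_i is a scalar by Schur,
    equal to its conjugate because it commutes with g_i, hence +-I; an element
    of U(N) tau commuting with K would make rho self-dual (centralizer_lifts).
    The order e is 2: every exp(ad X) with X in the complexified Lie algebra
    fixes the central direction i I of u(N), which Ad(g) negates for g in
    U(N) tau, whereas g^2 is in U(N), hence is an exponential
    (Out_order_Utau).

    Non-isomorphism.  An isomorphism restricts to the identity components.  K
    and KT are not isomorphic, because K n T would then be a connected group
    containing -I, thus all of T; but the semisimple group K does not contain T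
    (not_iso_with_scalars, semisimple_scalars).  An isomorphism H_1 -> H_2, or
    H_3 -> H_4, sends g1 to k z g2 with k in K and z in T, and comparing the
    images of g1 X and theta_1(X) g1 shows that theta_1 and theta_2 are
    conjugate in Out(K), provided that the isomorphism maps K to itself
    (iso_conjugate).  For H_3 and H_4 this means that an automorphism p of KT
    preserves K, which is usually read off from K being the commutator subgroup
    of KT.  Perfectness of K is replaced here by a statement that needs no
    structure theory (unit_scalars_sub): if a connected closed irreducible
    subgroup K of U(n) has a proper closed subgroup K1 containing all
    commutators, then K contains T.  It applies to K1 = {X in K | p X in K},
    which contains the commutators since p X is in K up to a scalar.

    The statement unit_scalars_sub is the main step.  As K is connected, K1 is
    not open in it, so there are elements k outside K1 tending to 1; they may be
    chosen nearest to 1 in their cosets k K1.  By compactness (k - 1)/|k - 1|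
    has a limit X, a nonzero skew-Hermitian matrix that the choice of k makes
    orthogonal to the directions along which K1 approaches 1.  For h in K the
    matrix Y = h X h^-1 - X is such a direction, as the limit of the normalized
    commutators of h and k; so tr(X Y) = 0, which for the invariant scalar
    product forces Y = 0.  Hence X commutes with K, is a scalar i mu, and the
    powers of the k fill up T in the limit.

    Dimension data.  Let sigma be an irreducible representation of G, and z in
    T.  The operator J = sigma(z) - sigma(conj z) commutes with U(N) and
    anticommutes with U(N) tau, so its kernel is G-invariant and J is 0 or
    invertible.  If J = 0 for every z, then T acts trivially, because every unit
    scalar is of the form z / conj z; so H_1 and H_3 have the same fixed
    vectors, and so do H_2 and H_4.  If J is invertible for some z, then T
    fixes no nonzero vector, whence the data of H_3 and H_4 vanish; and on the
    K-fixed vectors J exchanges the eigenvalues 1 and -1 of both g1 and g2, so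
    that H_1 and H_2 both fix half of that space (dimension_datum_combination).
*)

Local Notation iota := (@Defs.iota _ _).

(** * Schur's lemma and the groups generated by K and a lift *)

(** The eigenspace of M for one of its eigenvalues is an invariant subspace. *)
Lemma schur (C : numClosedFieldType) m n (K : set 'M[C]_m)
    (s : 'M[C]_m -> 'M[C]_n) (M : 'M[C]_n) :
  irreducible_rep K s -> (forall X, K X -> s X *m M = M *m s X) ->
  exists c, M = c%:M.
Proof.
move=> [_ n_gt0 irr] cM.
have [c /eigenvalueP[v vM v0]] := eigenvalue_closed M^T n_gt0.
exists c; pose A := M - c%:M; pose W := lker (linfun (mulmx A : 'cV_n -> 'cV_n)).
have WP w : (w \in W) = (A *m w == 0) by rewrite memv_ker lfunE.
have Av0 : v^T \in W.
  rewrite WP; apply/eqP/(can_inj trmxK).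
  by rewrite trmx_mul trmxK linearB /= tr_scalar_mx mulmxBr vM mul_mx_scalar
             subrr trmx0.
case: (irr W) => [X w KX|W0|WT].
- rewrite !WP => /eqP Aw0; apply/eqP.
  by rewrite mulmxA mulmxBl mul_scalar_mx -cM // -mul_mx_scalar -mulmxBr
             -mulmxA Aw0 mulmx0.
- move: Av0 v0; rewrite W0 memv0 => /eqP/(congr1 trmx).
  by rewrite trmxK trmx0 => ->; rewrite eqxx.
- apply/subr0_eq/matrixP => i j; have : delta_mx j 0 \in W by rewrite WT memvf.
  by rewrite WP -colE => /eqP/matrixP/(_ i 0); rewrite !mxE.
Qed.

Section Algebra.
Variables (C : numClosedFieldType) (N : nat).
Implicit Types (X Y : 'M[C]_N) (K L : set 'M[C]_N) (g : 'M[C]_(N + N)).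

Lemma iota1 : iota 1%:M = 1%:M :> 'M[C]_(N + N).
Proof. by rewrite /iota map_mx1 -scalar_mx_block. Qed.

Lemma iotaN X : iota (- X) = - iota X.
Proof. by rewrite /iota map_mxN opp_block_mx !oppr0. Qed.

Lemma iota_unit X : X \in unitmx -> iota X \in unitmx.
Proof.
by move=> uX; have /mulmx1_unit[] : iota X *m iota (invmx X) = 1%:M;
  rewrite -?iotaM ?mulmxV ?iota1.
Qed.

Lemma iotaV X : X \in unitmx -> iota (invmx X) = invmx (iota X).
Proof.
move=> uX; apply: (can_inj (mulmxK (iota_unit uX))).
by rewrite -iotaM mulVmx // mulVmx ?iota_unit // iota1.
Qed.

Lemma iota_tau X Y : iota X *m tau C N *m iota Y = iota (X *m map_mx Num.conj Y) *m tau C N.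
Proof.
have tu : tau C N \in unitmx by have /mulmx1_unit[] := @tau_sq C N.
rewrite iotaM -!mulmxA; congr (_ *m _).
by rewrite -conj_tau /conjm mulmxKV.
Qed.

Lemma tau_unit : tau C N \in @unitmx C (N + N).
Proof. by have /mulmx1_unit[] := @tau_sq C N. Qed.

Lemma map_conjK X : map_mx Num.conj (map_mx Num.conj X) = X.
Proof. by apply/matrixP => i j; rewrite !mxE conjCK. Qed.

Lemma unitary_scalar n (c : C) : (0 < n)%N ->
  (c%:M : 'M[C]_n) \is unitarymx -> `|c| = 1.
Proof.
move=> n0 /unitarymxP; rewrite tr_scalar_mx map_scalar_mx -scalar_mxM.
move=> /matrixP/(_ (Ordinal n0) (Ordinal n0)); rewrite !mxE eqxx !mulr1n.
by rewrite -normCK => /eqP; rewrite sqrp_eq1 // => /eqP.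
Qed.
Lemma invmxM n (A B : 'M[C]_n) : A \in unitmx -> B \in unitmx ->
  invmx (A *m B) = invmx B *m invmx A.
Proof.
move=> uA uB; have uAB : A *m B \in unitmx by rewrite unitmx_mul uA.
apply: (can_inj (mulmxK uAB)); rewrite mulVmx //.
by rewrite -mulmxA (mulmxA (invmx A)) mulVmx // mul1mx mulVmx.
Qed.

Lemma subgroupU : subgroup (U N : set 'M[C]_N).
Proof.
split=> [X|| X Y|X]; rewrite /U /=.
- exact: unitarymx_unit.
- by apply/unitarymxP; rewrite trmx1 map_mx1 mulmx1.
- exact: mul_unitarymx.
- by move=> uX; rewrite invmx_unitary // trmxC_unitary.
Qed.

Definition normalizes L g :=
  forall X, L X -> exists2 Y, L Y & g *m iota X = iota Y *m g.

(** When g normalizes iota L and its square lies in iota L, this is the group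
    generated by iota L and g. *)
Definition ext L g : set 'M[C]_(N + N) :=
  iota @` L `|` [set iota X *m g | X in L].

Lemma Utau_unit g : Utau g -> g \in unitmx.
Proof.
case=> X uX <-; rewrite unitmx_mul tau_unit andbT iota_unit //.
exact: unitarymx_unit.
Qed.

Lemma subgroup_ext L g : subgroup L -> g \in unitmx -> normalizes L g ->
  (iota @` L) (g *m g) -> subgroup (ext L g).
Proof.
move=> sL ug gL [G LG Gg]; have [uL L1 LM LV] := sL.
split=> [Y [[X LX <-]|[X LX <-]]|| A B|A].
- exact/iota_unit/uL.
- by rewrite /= unitmx_mul ug andbT; apply/iota_unit/uL.
- by left; exists 1%:M => //; rewrite iota1.
- move=> [[X LX <-]|[X LX <-]] [[Y LY <-]|[Y LY <-]].
  + by left; exists (X *m Y); [apply: LM|rewrite iotaM].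
  + by right; exists (X *m Y); [apply: LM|rewrite iotaM mulmxA].
  + have [Z LZ ZE] := gL _ LY.
    by right; exists (X *m Z); [apply: LM|rewrite iotaM -!mulmxA ZE].
  + have [Z LZ ZE] := gL _ LY.
    left; exists (X *m (Z *m G)); first by apply/LM => //; apply: LM.
    by rewrite !iotaM Gg -!mulmxA (mulmxA g _ g) ZE -!mulmxA.
- move=> [[X LX <-]|[X LX <-]].
    by left; exists (invmx X); [apply: LV|rewrite iotaV //; apply: uL].
  have [Z LZ ZE] := gL _ (LV _ (LM _ _ LX LG)).
  right; exists Z => //; rewrite -ZE.
  have uA : iota X *m g \in unitmx.
    by rewrite unitmx_mul ug andbT; apply/iota_unit/uL.
  apply: (can_inj (mulmxK uA)); rewrite mulVmx // -mulmxA.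
  have -> : iota (invmx (X *m G)) *m (iota X *m g) = invmx g.
    apply: (can_inj (mulmxK ug)); rewrite mulVmx // -!mulmxA -Gg -iotaM -iotaM.
    by rewrite mulVmx ?iota1 //; apply/uL/LM.
  by rewrite mulmxV.
Qed.

Lemma generated_min n (A H : set 'M[C]_n) :
  subgroup H -> A `<=` H -> generated A `<=` H.
Proof. by move=> sH AH X; apply. Qed.

Lemma generated_ext L g (A : set 'M[C]_(N + N)) : subgroup (ext L g) -> A `<=` ext L g ->
  (forall H, subgroup H -> A `<=` H -> iota @` L `<=` H /\ H g) ->
  generated A = ext L g.
Proof.
move=> sH AH Hmin; apply/seteqP; split; first exact: generated_min.
move=> X HX H sH' AH'; have [LH Hg] := Hmin H sH' AH'.
have [_ _ HM _] := sH'.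
case: HX => [|[Y LY <-]]; first exact: LH.
by apply: HM => //; apply: LH; exists Y.
Qed.

Lemma ext_iota L g X : L X -> ext L g (iota X).
Proof. by left; exists X. Qed.

Lemma ext_g L g : L 1%:M -> ext L g g.
Proof. by move=> L1; right; exists 1%:M => //; rewrite iota1 mul1mx. Qed.

Lemma extensionE L g : subgroup (ext L g) -> L 1%:M -> extension L g = ext L g.
Proof.
move=> sH L1; apply: generated_ext => //.
  by move=> X [[Y LY <-]|->]; [apply: ext_iota|apply: ext_g].
by move=> H _ AH; split=> [X LX|]; apply: AH; [left|right].
Qed.

Definition unit_scalars : set 'M[C]_N := [set z%:M | z in [set z : C | `|z| = 1]].

Definition with_scalars K : set 'M[C]_N := prodset K unit_scalars.

Lemma unit_scalars_U : unit_scalars `<=` U N.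
Proof.
move=> _ [z /= z1 <-]; apply/unitarymxP.
by rewrite tr_scalar_mx map_scalar_mx /= -scalar_mxM -normCK z1 expr1n.
Qed.

Lemma subgroup_unit_scalars : subgroup unit_scalars.
Proof.
split=> [X|| _ _ [z /= z1 <-] [w /= w1 <-]|_ [z /= z1 <-]].
- by move/unit_scalars_U => uX; apply: unitarymx_unit.
- by exists 1 => //=; rewrite normr1.
- by exists (z * w); rewrite /= ?normrM ?z1 ?w1 ?mulr1 ?scalar_mxM.
- by exists z^-1; rewrite /= ?normfV ?z1 ?invr1 // invmx_scalar.
Qed.

Lemma subgroup_with_scalars K : subgroup K -> subgroup (with_scalars K).
Proof.
move=> [uK K1 KM KV]; have [uT T1 TM TV] := subgroup_unit_scalars.
have TC z X : unit_scalars z -> X *m z = z *m X by case=> c _ <-; rewrite scalar_mxC.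
split=> [_ [X KX [Y TY <-]]|| _ _ [X KX [z Tz <-]] [Y KY [w Tw <-]]|_ [X KX [z Tz <-]]].
- by rewrite /= unitmx_mul; apply/andP; split; [apply: uK|apply: uT].
- by exists 1%:M => //; exists 1%:M => //; rewrite mulmx1.
- exists (X *m Y); first exact: KM.
  exists (z *m w); first exact: TM.
  by rewrite -!mulmxA (mulmxA Y) (TC z Y) // -!mulmxA.
- exists (invmx X); first exact: KV.
  exists (invmx z); first exact: TV.
  by rewrite invmxM; [rewrite (TC (invmx z))//; apply: TV|apply: uK|apply: uT].
Qed.

Lemma sub_with_scalars K : K `<=` with_scalars K.
Proof.
move=> X KX; exists X => //; exists 1%:M; last by rewrite mulmx1.
by have [] := subgroup_unit_scalars.
Qed.

Lemma unit_scalars_with_scalars K : K 1%:M -> unit_scalars `<=` with_scalars K.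
Proof. by move=> K1 z Tz; exists 1%:M => //; exists z; rewrite ?mul1mx. Qed.

Lemma with_scalars_U K : K `<=` U N -> with_scalars K `<=` U N.
Proof.
move=> KU _ [X KX [z Tz <-]]; have [_ _ UM _] := subgroupU.
by apply: UM; [apply: KU|apply: unit_scalars_U].
Qed.

Lemma unit_scalarsC z X : unit_scalars z -> z *m X = X *m z.
Proof. by case=> c _ <-; rewrite scalar_mxC. Qed.

Lemma centerUE K : K `<=` U N -> irreducible_rep K id -> Defs.center (U N) = unit_scalars.
Proof.
move=> KU irr; apply/seteqP; split=> X.
  move=> [uX cX]; have [c Xc] := schur irr (fun Y KY => esym (cX Y (KU _ KY))).
  exists c => //=; have [_ N0 _] := irr.
  by apply: (unitary_scalar N0); rewrite -Xc.
by move=> TX; split=> [|Y _]; [apply: unit_scalars_U|apply: unit_scalarsC].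
Qed.

Lemma Utau_scalar g (z : C) : Utau g -> g *m iota z%:M = iota (z^*)%:M *m g.
Proof.
by case=> X _ <-; rewrite iota_tau map_scalar_mx /= scalar_mxC iotaM mulmxA.
Qed.

End Algebra.

(** * Lifts of the involutions *)
Section Lifts.
Variables (C : numClosedFieldType) (N : nat).
Variables (K : set 'M[C]_N) (theta : 'M[C]_N -> 'M[C]_N).
Hypotheses (sK : subgroup K) (KU : K `<=` U N) (irr : irreducible_rep K id).
Hypotheses (thK : forall X, K X -> K (theta X))
           (thth : forall X, K X -> theta (theta X) = X).
Implicit Types (X Y A : 'M[C]_N) (g : 'M[C]_(N + N)).

Lemma dual_conj X : X \is unitarymx -> (invmx X)^T = map_mx Num.conj X.
Proof. by move=> uX; rewrite invmx_unitary // -map_trmx trmxK. Qed.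

Lemma real_unit_sign (d : C) : d^* = d -> `|d| = 1 -> d = 1 \/ d = -1.
Proof.
move=> dr d1; have : d ^+ 2 == 1 by rewrite expr2 -{2}dr -normCK d1 expr1n.
by rewrite sqrf_eq1 => /orP[]/eqP; [left|right].
Qed.

(** If A intertwines theta^* rho and rho^* then A A^* commutes with every
    conj X, X in K, so it is a positive scalar, and A can be rescaled to a
    unitary matrix B.  Then g = B^-1 tau induces theta on K, and g^2 is a
    scalar, because theta is an involution and rho is irreducible. *)
Lemma lifts_exist : rep_iso K (id \o theta) (dual_rep id) -> exists g, lifts K theta g.
Proof.
move=> [A uA AP]; have [_ N0 _] := irr.
have {}AP X : K X -> A *m theta X = map_mx Num.conj X *m A.
  by move=> KX; have /= -> := AP X KX; rewrite /dual_rep dual_conj //; apply: KU.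
pose M := A *m (A^t*)%sesqui.
have Mcomm X : K X -> X *m map_mx Num.conj M = map_mx Num.conj M *m X.
  move=> KX; have uX := KU KX; have uY := KU (thK KX).
  apply: (can_inj (@map_conjK C N)); rewrite !map_mxM !map_conjK /M.
  rewrite mulmxA -AP // -!mulmxA; congr (_ *m _).
  apply: (can_inj (mulKVmx (unitarymx_unit uY))).
  rewrite mulKmx; last exact: unitarymx_unit.
  rewrite invmx_unitary // mulmxA -map_mxM -trmx_mul AP // trmx_mul map_mxM /=.
  by rewrite mulmxKtV ?conjC_unitary.
have [c' cM] := schur irr Mcomm.
have {cM} [c cM] : exists c, M = c%:M.
  by exists (c'^* ); rewrite -map_scalar_mx -cM map_conjK.
have c_gt0 : 0 < c.
  have c_ge0 : 0 <= c.
    have := congr1 (fun Z : 'M[C]_N => Z (Ordinal N0) (Ordinal N0)) cM.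
    rewrite !mxE eqxx mulr1n => <-; apply: sumr_ge0 => i _.
    by rewrite !mxE mul_conjC_ge0.
  rewrite lt_def c_ge0 andbT; apply/eqP => c0.
  have : M \in unitmx.
    by rewrite unitmx_mul uA map_unitmx unitmx_tr uA.
  by rewrite cM c0 unitmxE det_scalar unitfE expf_eq0 N0 eqxx.
(* A A^* = c, so dividing A by the square root of c makes it unitary. *)
pose B := (sqrtC c)^-1 *: A.
have s0 : sqrtC c != 0 by rewrite sqrtC_eq0 gt_eqF.
have uB : B \is unitarymx.
  apply/unitarymxP; rewrite /B linearZ /= map_mxZ -scalemxAl -scalemxAr scalerA.
  rewrite -/M cM fmorphV /= geC0_conj ?sqrtC_ge0 ?ltW // -invfM -expr2 sqrtCK.
  by rewrite scale_scalar_mx mulVf // gt_eqF.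
have uBm := unitarymx_unit uB.
have BP X : K X -> B *m theta X = map_mx Num.conj X *m B.
  by move=> KX; rewrite /B -scalemxAl AP // scalemxAr.
pose P := invmx B; pose g := iota P *m tau C N.
have uP : P \in unitmx by rewrite unitmx_inv.
have PU : P \is unitarymx by rewrite /P invmx_unitary // trmxC_unitary.
have gU : Utau g by exists P.
have conjg X : K X -> conjm g (iota X) = iota (theta X).
  move=> KX; apply: (can_inj (mulmxK (Utau_unit gU))).
  rewrite /conjm mulmxKV ?Utau_unit // iota_tau /g mulmxA -iotaM.
  congr (iota _ *m _); apply: (can_inj (mulKmx uBm)).
  by rewrite [RHS]mulmxA BP // mulmxA mulmxV // mul1mx mulmxK.
exists g; split=> //; pose Q := P *m map_mx Num.conj P.
have gg : g *m g = iota Q.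
  rewrite /g mulmxA iota_tau -mulmxA tau_sq mulmx1 //.
have [X KX|d Qd] := schur irr (M := Q).
  apply: (@iota_inj C N); rewrite iotaM [RHS]iotaM -!gg.
  have ug := Utau_unit gU.
  have gi Y : K Y -> g *m iota Y = iota (theta Y) *m g.
    by move=> KY; rewrite -conjg // /conjm mulmxKV.
  by rewrite -[RHS]mulmxA gi // [RHS]mulmxA gi ?thth ?mulmxA //; apply: thK.
(* g^2 = iota (P conj P) and P commutes with the scalar P conj P = d, so
   conj P P = d as well: the scalar d is its own conjugate. *)
have Qd' : map_mx Num.conj P *m P = d%:M.
  by apply: (can_inj (mulKmx uP)); rewrite mulmxA -/Q Qd scalar_mxC.
have dr : d^* = d.
  have := congr1 (map_mx Num.conj) Qd.
  rewrite map_mxM map_conjK Qd' map_scalar_mx => /matrixP/(_ (Ordinal N0) (Ordinal N0)).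
  by rewrite !mxE eqxx !mulr1n => <-.
have d1 : `|d| = 1.
  by apply: (unitary_scalar N0); rewrite -Qd mul_unitarymx ?conjC_unitary.
rewrite gg Qd; case: (real_unit_sign dr d1) => ->; [left|right].
  exact: iota1.
by rewrite raddfN /= iotaN iota1.
Qed.

Variable g : 'M[C]_(N + N).
Hypotheses (KN1 : K (- 1%:M)) (gl : lifts K theta g).

Lemma lifts_comm X : K X -> g *m iota X = iota (theta X) *m g.
Proof.
case: gl => gU _ gc KX; rewrite -gc // /conjm mulmxKV //; exact: Utau_unit.
Qed.

Lemma lifts_normalizes : normalizes K g.
Proof. by move=> X KX; exists (theta X); [apply: thK|apply: lifts_comm]. Qed.

Lemma lifts_sq L : K `<=` L -> (iota @` L) (g *m g).
Proof.
have [_ K1 _ _] := sK.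
case: gl => _ [->|->] _ KL; [exists 1%:M|exists (- 1%:M)]; rewrite ?iotaN ?iota1 //.
all: exact: KL.
Qed.

Lemma lifts_normalizes_with_scalars : normalizes (with_scalars K) g.
Proof.
move=> _ [X KX [_ [z /= z1 <-] <-]].
exists (theta X *m (z^*)%:M).
  exists (theta X); first exact: thK.
  by exists (z^*)%:M => //; exists (z^* ); rewrite //= norm_conjC.
rewrite iotaM mulmxA lifts_comm // -mulmxA Utau_scalar; last by case: gl.
by rewrite mulmxA iotaM.
Qed.

Lemma subgroup_ext_lift : subgroup (ext K g).
Proof.
apply: subgroup_ext => //; [|exact: lifts_normalizes|exact: lifts_sq].
by case: gl => /Utau_unit.
Qed.

Lemma subgroup_ext_with_scalars : subgroup (ext (with_scalars K) g).
Proof.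
apply: subgroup_ext; [exact: subgroup_with_scalars| |exact: lifts_normalizes_with_scalars|].
  by case: gl => /Utau_unit.
by apply: lifts_sq; apply: sub_with_scalars.
Qed.

Lemma extension_lift : extension K g = ext K g.
Proof. by apply: extensionE; [apply: subgroup_ext_lift|case: sK]. Qed.

Lemma ext_sub L L' : L `<=` L' -> ext L g `<=` ext L' g.
Proof. by move=> LL' _ [[X LX <-]|[X LX <-]]; [left|right]; exists X => //; apply: LL'. Qed.

Lemma adjoin_centerE : adjoin_center (extension K g) = ext (with_scalars K) g.
Proof.
have [_ K1 _ _] := sK.
rewrite extension_lift /adjoin_center (centerUE KU irr).
apply: generated_ext; first exact: subgroup_ext_with_scalars.
  move=> X [|[Y TY <-]]; first by apply: ext_sub; apply: sub_with_scalars.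
  by apply: ext_iota; apply: unit_scalars_with_scalars.
move=> H [_ _ HM _] AH; split; last by apply: AH; left; apply: ext_g.
move=> _ [_ [X KX [z Tz <-]] <-]; rewrite iotaM; apply: HM; apply: AH.
  by left; apply: ext_iota.
by right; exists z.
Qed.

Lemma ext_Uext L : L `<=` U N -> ext L g `<=` Uext N.
Proof.
move=> LU _ [[X LX <-]|[X LX <-]]; first by left; exists X => //; apply: LU.
case: gl => [[Y UY <-] _ _]; right; exists (X *m Y); last by rewrite iotaM mulmxA.
by rewrite /U /= mul_unitarymx //; apply: LU.
Qed.

(** An element iota A of the centralizer is a scalar c by irreducibility, and
    c = conj c since it commutes with g; as |c| = 1 it is central.  An element
    iota A tau cannot occur: commuting with K it would intertwine rho with its
    conjugate, which is its dual. *)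
Lemma centralizer_lifts (H : set 'M[C]_(N + N)) :
  ~ rep_iso K id (dual_rep id) ->
  iota @` K `<=` H -> H g -> H `<=` Uext N ->
  centralizer (Uext N) H = Defs.center (Uext N).
Proof.
move=> hns KH Hg HU; apply/seteqP; split=> X [UX cX]; split=> //; last first.
  by move=> Y HY; apply/cX/HU.
case: UX cX => [[A UA <-]|[A UA <-]] cX.
  have [Y KY|c Ac] := schur irr (M := A).
    have HY : H (iota Y) by apply: KH; exists Y.
    by apply: (@iota_inj C N); rewrite !iotaM cX.
  have [_ N0 _] := irr.
  have gU : Utau g by case: gl.
  have dr : c^* = c.
    have := cX _ Hg; rewrite Ac Utau_scalar // => /(can_inj (mulmxK (Utau_unit gU))).
    move/(@iota_inj C N)/matrixP/(_ (Ordinal N0) (Ordinal N0)).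
    by rewrite !mxE eqxx !mulr1n => <-.
  have d1 : `|c| = 1.
    by apply: (unitary_scalar N0); rewrite -Ac.
  move=> Y _; rewrite Ac; case: (real_unit_sign dr d1) => ->.
    by rewrite iota1 mul1mx mulmx1.
  by rewrite raddfN /= iotaN iota1 mulNmx mulmxN mul1mx mulmx1.
case: hns; have uA := unitarymx_unit UA.
exists (invmx A); rewrite ?unitmx_inv // => k Kk.
rewrite /dual_rep dual_conj; last exact: KU.
have := cX (iota k) (KH _ (ex_intro2 _ _ _ Kk erefl)).
rewrite iota_tau mulmxA -iotaM => /(can_inj (mulmxK (tau_unit C N))).
move/(@iota_inj C N) => Ak; apply: (can_inj (mulKmx uA)).
by rewrite mulmxA mulmxV // mul1mx mulmxA Ak mulmxK.
Qed.

End Lifts.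

(** * Dimension data *)
Section DimensionDatum.
Variables (C : numClosedFieldType) (m n : nat).
Implicit Types (H : set 'M[C]_m) (s : 'M[C]_m -> 'M[C]_n).

Definition fixes H s d (V : 'M[C]_(n, d)) : Prop := forall X, H X -> s X *m V = V.

(** The columns of V need not be independent: a basis of its column space is
    again fixed. *)
Lemma dimension_datum_le H s e (V : 'M[C]_(n, e)) :
  fixes H s V -> (\rank V <= dimension_datum H s)%N.
Proof.
move=> fV; have le_rn : (\rank V < n.+1)%N by rewrite ltnS rank_leq_row.
rewrite /dimension_datum.
apply: (leq_trans _ (leq_bigmax_cond (Ordinal le_rn) _)) => //.
apply/asboolP; exists (col_base V); first
  by apply/eqP; rewrite -[_ == _]/(row_full _) col_base_full.
move=> X HX; have /row_freeP[B BP] := row_base_free V.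
by rewrite -[col_base V]mulmx1 -BP [X in s _ *m X]mulmxA
  [col_base V *m (_ *m _)]mulmxA mulmx_base mulmxA fV.
Qed.

Lemma dimension_datum_leP H s b :
  (forall d (V : 'M[C]_(n, d)), \rank V = d -> fixes H s V -> (d <= b)%N) ->
  (dimension_datum H s <= b)%N.
Proof. by move=> hb; apply/bigmax_leqP => d /asboolP[V rV fV]; apply: hb rV fV. Qed.

Lemma dimension_datum_eq H H' s :
  (forall d (V : 'M[C]_(n, d)), fixes H s V <-> fixes H' s V) ->
  dimension_datum H s = dimension_datum H' s.
Proof.
move=> HH'; apply/eqP; rewrite eqn_leq; apply/andP; split.
all: by apply: dimension_datum_leP => d V rV /HH'/dimension_datum_le; rewrite rV.
Qed.

End DimensionDatum.

Section UextRepresentations.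
Variables (C : numClosedFieldType) (N n : nat).
Variables (K : set 'M[C]_N) (s : 'M[C]_(N + N) -> 'M[C]_n).
Hypotheses (sK : subgroup K) (KU : K `<=` U N) (KN1 : K (- 1%:M)).
Hypothesis (irrs : irreducible_rep (Uext N) s).
Implicit Types (g : 'M[C]_(N + N)) (th : 'M[C]_N -> 'M[C]_N).

Let sM (X Y : 'M[C]_(N + N)) : Uext N X -> Uext N Y -> s (X *m Y) = s X *m s Y.
Proof. by case: irrs => [[_ sM _] _ _]; apply: sM. Qed.

Let s1 : s 1%:M = 1%:M.
Proof. by case: irrs => [[]]. Qed.

Let GU (X : 'M[C]_N) : X \is unitarymx -> Uext N (iota X).
Proof. by move=> uX; left; exists X. Qed.

Let GK (X : 'M[C]_N) : K X -> Uext N (iota X).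
Proof. by move/KU; apply: GU. Qed.

Let GT g : Utau g -> Uext N g.
Proof. by right. Qed.

Let UT (z : C) : `|z| = 1 -> Uext N (iota z%:M).
Proof. by move=> z1; apply: GU; apply: unit_scalars_U; exists z. Qed.

Lemma fixes_ext L g d (V : 'M[C]_(n, d)) : L `<=` U N -> L 1%:M -> Utau g ->
  fixes (ext L g) s V <-> fixes (iota @` L) s V /\ s g *m V = V.
Proof.
move=> LU L1 gU; split=> [fV|[fL fg] X [LX|[Y LY <-]]].
- split=> [X LX|]; first by apply: fV; left.
  by apply: fV; apply: ext_g.
- exact: fL.
- rewrite sM; first by rewrite -mulmxA fg fL //; exists Y.
  + by apply: GU; apply: LU.
  + exact: GT.
Qed.

(** Ad(g) exchanges the central elements z and conj z for g in U(N) tau, so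
    that this operator is semi-invariant under G for the sign character of
    G / U(N). *)
Definition scalar_gap (z : C) : 'M[C]_n := s (iota z%:M) - s (iota (z^*)%:M).

Lemma scalar_gap_comm z (X : 'M[C]_N) : `|z| = 1 -> X \is unitarymx ->
  s (iota X) *m scalar_gap z = scalar_gap z *m s (iota X).
Proof.
move=> z1 uX; have zc1 : `|z^*| = 1 by rewrite norm_conjC.
rewrite /scalar_gap mulmxBr mulmxBl -!sM ?GU ?UT //; try exact: GU; try exact: UT.
by rewrite -!iotaM !scalar_mxC.
Qed.

Lemma scalar_gap_anticomm z g : `|z| = 1 -> Utau g ->
  s g *m scalar_gap z = - (scalar_gap z *m s g).
Proof.
move=> z1 gU; have zc1 : `|z^*| = 1 by rewrite norm_conjC.
rewrite /scalar_gap mulmxBr mulmxBl -!sM; try exact: GT; try exact: UT.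
by rewrite !Utau_scalar // conjCK opprB.
Qed.

(** The kernel of the semi-invariant operator scalar_gap z is a
    subrepresentation. *)
Lemma scalar_gap_dichotomy z : `|z| = 1 -> scalar_gap z = 0 \/ scalar_gap z \in unitmx.
Proof.
move=> z1; have [_ _ irr] := irrs.
pose W := lker (linfun (mulmx (scalar_gap z) : 'cV_n -> 'cV_n)).
have WP w : (w \in W) = (scalar_gap z *m w == 0) by rewrite memv_ker lfunE.
case: (irr W) => [X v GX|W0|WT].
- rewrite !WP => /eqP Jv0; rewrite mulmxA.
  case: GX => [[Y uY <-]|gU]; first by rewrite -scalar_gap_comm // -mulmxA Jv0 mulmx0.
  by rewrite -[scalar_gap z *m _]opprK -scalar_gap_anticomm // mulNmx -mulmxA Jv0 mulmx0 oppr0.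
- right; rewrite -unitmx_tr -row_free_unit -kermx_eq0; apply/eqP/row_matrixP => i.
  rewrite row0; apply: trmx_inj; rewrite trmx0; apply/eqP; rewrite -memv0 -W0 WP.
  have /(congr1 (fun A => (row i A)^T)) := mulmx_ker (scalar_gap z)^T.
  by rewrite row_mul trmx_mul trmxK row0 trmx0 => ->.
- left; apply/matrixP => i j; have : delta_mx j 0 \in W by rewrite WT memvf.
  by rewrite WP -colE => /eqP/matrixP/(_ i 0); rewrite !mxE.
Qed.

(** Let J be an invertible gap and V a matrix of independent vectors fixed by
    ext K g1.  J commutes with K and anticommutes with g1, so [V, J V] consists
    of 2d independent K-fixed vectors.  The involution g2 splits their span
    into a fixed part and a negated part, whose dimensions add up to at least
    2d; J carries the negated part to vectors fixed by g2. *)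
Lemma dimension_datum_half g1 g2 th1 th2 z : `|z| = 1 -> scalar_gap z \in unitmx ->
  lifts K th1 g1 -> lifts K th2 g2 ->
  (forall X, K X -> K (th2 X)) -> (forall X, K X -> th2 (th2 X) = X) ->
  (dimension_datum (ext K g1) s <= dimension_datum (ext K g2) s)%N.
Proof.
move=> z1 uJ [g1U _ _] gl2 thK thth.
have [g2U g2s _] := gl2.
have [_ K1 _ _] := sK; have [Jz JE] : {A | A = scalar_gap z} by exists (scalar_gap z).
rewrite -JE in uJ.
have Jg1 : s g1 *m Jz = - (Jz *m s g1) by rewrite JE scalar_gap_anticomm.
have Jg2 : s g2 *m Jz = - (Jz *m s g2) by rewrite JE scalar_gap_anticomm.
have JK X : K X -> s (iota X) *m Jz = Jz *m s (iota X).
  by move=> KX; rewrite JE scalar_gap_comm //; apply: KU.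
apply: dimension_datum_leP => d V rV /(fixes_ext V KU K1 g1U)[fV gV].
pose W := row_mx V (Jz *m V).
have fW : fixes (iota @` K) s W.
  move=> _ [X KX <-]; rewrite /W mul_mx_row mulmxA JK //.
  by rewrite -mulmxA fV //; exists X.
have rW : (d + d <= \rank W)%N.
  have rJV : \rank (Jz *m V) = d by rewrite eqmxMfull // row_full_unit.
  (* 1 + g1 and 1 - g1 separate the eigenvectors V (for 1) and J V (for -1):
     the product below is block diagonal with blocks 2 V and 2 J V. *)
  suff e : \rank (col_mx (1%:M + s g1) (1%:M - s g1) *m W) = (d + d)%N.
    by apply: leq_trans (mxrankM_maxr (col_mx (1%:M + s g1) (1%:M - s g1)) W); rewrite e.
  rewrite /W mul_col_row !mulmxDl !mulNmx !mul1mx gV.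
  rewrite (mulmxA (s g1)) Jg1 mulNmx -!mulmxA gV subrr opprK subrr.
    have -> (e : nat) (B : 'M[C]_(n, e)) : B + B = 2%:R *: B by rewrite scaler_nat.
    have -> (e : nat) (B : 'M[C]_(n, e)) : B + B = 2%:R *: B by rewrite scaler_nat.
    rewrite rank_diag_block_mx !mxrank_scale_nz ?pnatr_eq0 //.
  by rewrite rV rJV.
have g2g2 : s g2 *m (s g2 *m W) = W.
  rewrite mulmxA -sM; try exact: GT.
  by case: g2s => ->; [rewrite s1 mul1mx|apply: fW; exists (- 1%:M); rewrite ?iotaN ?iota1].
have fgW : fixes (iota @` K) s (s g2 *m W).
  move=> _ [X KX <-]; have KtX := thK _ KX.
  rewrite mulmxA -sM; [|exact: GK|exact: GT].
  rewrite -{1}(thth _ KX) -(lifts_comm gl2 KtX) sM; [|exact: GT|exact: GK].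
  by rewrite -mulmxA fW //; exists (th2 X).
have rp : (\rank (W + s g2 *m W)%R <= dimension_datum (ext K g2) s)%N.
  apply: dimension_datum_le; apply/fixes_ext => //; split.
    by move=> X KX; rewrite mulmxDr (fW _ KX) (fgW _ KX).
  by rewrite mulmxDr g2g2 addrC.
have rm : (\rank (W - s g2 *m W)%R <= dimension_datum (ext K g2) s)%N.
  have -> : \rank (W - s g2 *m W)%R = \rank (Jz *m (W - s g2 *m W))%R.
    by rewrite eqmxMfull // row_full_unit.
  apply: dimension_datum_le; apply/fixes_ext => //; split.
    move=> _ [X KX <-]; rewrite mulmxA JK //.
    have iX : (iota @` K) (iota X) by exists X.
    by rewrite -mulmxA mulmxBr (fW _ iX) (fgW _ iX).
  by rewrite mulmxA Jg2 mulNmx -mulmxA mulmxBr g2g2 -mulmxN opprB.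
have : (d + d <= \rank (W + s g2 *m W)%R + \rank (W - s g2 *m W)%R)%N.
  apply: (leq_trans rW); apply: leq_trans (mxrank_add _ _).
  by rewrite addrACA subrr addr0 -mulr2n -scaler_nat mxrank_scale_nz ?pnatr_eq0.
move=> le_dd; rewrite -leq_double -!addnn; apply: (leq_trans le_dd).
exact: leq_add.
Qed.

Lemma sqrt_unit (w : C) : `|w| = 1 -> exists2 z, `|z| = 1 & w = z / z^*.
Proof.
move=> w1; have z1 : `|sqrtC w| = 1.
  by apply/eqP; rewrite -sqrp_eq1 // -normrX sqrtCK w1.
exists (sqrtC w) => //.
by rewrite -{1}[w]sqrtCK expr2; congr (_ * _); rewrite -[RHS]mul1r
  -[1](expr1n _ 2) -z1 normCK mulfK // conjC_eq0 -normr_gt0 z1.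
Qed.

(** If some gap is invertible, no nonzero vector is fixed by T, and by symmetry
    in dimension_datum_half the data of ext K g1 and ext K g2 agree.  If all
    gaps vanish, sigma(z) = sigma(conj z) = sigma(z)^-1, so sigma(z / conj z) =
    sigma(z)^2 = 1, and T acts trivially. *)
Lemma dimension_datum_combination g1 g2 th1 th2 :
  lifts K th1 g1 -> lifts K th2 g2 ->
  (forall X, K X -> K (th1 X)) -> (forall X, K X -> th1 (th1 X) = X) ->
  (forall X, K X -> K (th2 X)) -> (forall X, K X -> th2 (th2 X) = X) ->
  ((dimension_datum (ext K g1) s)%:Z - (dimension_datum (ext K g2) s)%:Z)
  - ((dimension_datum (ext (with_scalars K) g1) s)%:Z
     - (dimension_datum (ext (with_scalars K) g2) s)%:Z)
  = 0.
Proof.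
move=> l1 l2 t1 tt1 t2 tt2; have [_ K1 _ _] := sK.
have [g1U _ _] := l1; have [g2U _ _] := l2.
have [_ KT1 _ _] := subgroup_with_scalars sK; have KTU := with_scalars_U KU.
have [[z z1 uJ]|J0] := pselect (exists2 z, `|z| = 1 & scalar_gap z \in unitmx).
  have D0 g : Utau g -> dimension_datum (ext (with_scalars K) g) s = 0%N.
    move=> gU; apply/eqP; rewrite -leqn0; apply: dimension_datum_leP => d V rV.
    move=> /(fixes_ext V KTU KT1 gU)[fV _]; rewrite -rV.
    have fT (w : C) : `|w| = 1 -> s (iota w%:M) *m V = V.
      move=> w1; apply: fV; exists w%:M => //.
      by apply: unit_scalars_with_scalars => //; exists w.
    have JV : scalar_gap z *m V = 0.
      by rewrite mulmxBl !fT ?subrr // norm_conjC.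
    by rewrite -(mulKmx uJ V) JV mulmx0 mxrank0.
  rewrite !D0 // subrr subr0.
  suff -> : dimension_datum (ext K g1) s = dimension_datum (ext K g2) s.
    by rewrite subrr.
  apply/eqP; rewrite eqn_leq (dimension_datum_half z1 uJ l1 l2) //.
  by rewrite (dimension_datum_half z1 uJ l2 l1).
have sT (w : C) : `|w| = 1 -> s (iota w%:M) = 1%:M.
  move=> /sqrt_unit[z z1 ->]; have zc1 : `|z^*| = 1 by rewrite norm_conjC.
  case: (scalar_gap_dichotomy z1) => [/subr0_eq e|uJ]; last by case: J0; exists z.
  have zz : z * z^* = 1 by rewrite -normCK z1 expr1n.
  have z0 : z^* != 0 by rewrite -normr_gt0 zc1.
  have -> : (z^*)^-1 = z by apply: (mulIf z0); rewrite mulVf.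
  rewrite scalar_mxM iotaM sM; try exact: UT.
  by rewrite {1}e -sM; try exact: UT; rewrite -iotaM -scalar_mxM mulrC zz iota1.
have E g : Utau g -> dimension_datum (ext K g) s = dimension_datum (ext (with_scalars K) g) s.
  move=> gU; apply: dimension_datum_eq => d V.
  rewrite !fixes_ext //; split=> -[fV ->]; split=> // _ [X KX <-].
    case: KX => [Y KY [_ [z /= z1 <-] <-]]; rewrite iotaM sM; [|exact: GK|exact: UT].
    by rewrite sT // mulmx1; apply: fV; exists Y.
  by apply: fV; exists X => //; apply: sub_with_scalars.
by rewrite !E // subrr.
Qed.

End UextRepresentations.

(** * Topology of matrix spaces *)
Section MatrixTopology.
Variable C : numClosedFieldType.

Lemma cvg_mxP T (F : set_system T) {FF : Filter F} m n
    (f : T -> 'M[C]_(m, n)) (A : 'M[C]_(m, n)) :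
  (forall i j, f x i j @[x --> F] --> A i j) -> f x @[x --> F] --> A.
Proof.
move=> fA; apply/cvg_ballP => e e0.
have : \forall x \near F, forall ij : 'I_m * 'I_n,
    ball (A ij.1 ij.2) e (f x ij.1 ij.2).
  by apply: filter_forall => ij; have /cvg_ballP := fA ij.1 ij.2; apply.
by apply: filterS => x H; split=> // i j; apply: (H (i, j)).
Qed.

Lemma cvg_coord T (F : set_system T) {FF : Filter F} m n
    (f : T -> 'M[C]_(m, n)) (A : 'M[C]_(m, n)) i j :
  f x @[x --> F] --> A -> f x i j @[x --> F] --> A i j.
Proof.
move=> fA; apply: (cvg_comp f (fun M : 'M[C]_(m, n) => M i j) fA).
exact: coord_continuous.
Qed.

Lemma cvg_sum_ord T (F : set_system T) {FF : Filter F} k (f : 'I_k -> T -> C) (l : 'I_k -> C) :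
  (forall i, f i x @[x --> F] --> l i) ->
  \sum_(i < k) f i x @[x --> F] --> \sum_(i < k) l i.
Proof.
elim: k f l => [|k IH] f l fl.
  under eq_fun do rewrite big_ord0; rewrite big_ord0; exact: cvg_cst.
under eq_fun do rewrite big_ord_recl; rewrite big_ord_recl.
by apply: cvgD => //; apply: IH.
Qed.

Lemma cvg_mulmx T (F : set_system T) {FF : Filter F} m n p
    (f : T -> 'M[C]_(m, n)) (g : T -> 'M[C]_(n, p))
    (A : 'M[C]_(m, n)) (B : 'M[C]_(n, p)) :
  f x @[x --> F] --> A -> g x @[x --> F] --> B -> f x *m g x @[x --> F] --> A *m B.
Proof.
move=> fA gB; apply: cvg_mxP => i j.
under eq_fun do rewrite mxE; rewrite mxE.
by apply: cvg_sum_ord => k; apply: cvgM; apply: cvg_coord.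
Qed.

Lemma cvg_conj T (F : set_system T) {FF : Filter F} (f : T -> C) (l : C) :
  f x @[x --> F] --> l -> (f x)^* @[x --> F] --> l^*.
Proof.
move/cvgrPdist_lt => fl; apply/cvgrPdist_lt => e e0.
by apply: filterS (fl e e0) => x; rewrite -rmorphB norm_conjC.
Qed.

Lemma cvg_conjmx T (F : set_system T) {FF : Filter F} m n
    (f : T -> 'M[C]_(m, n)) (A : 'M[C]_(m, n)) :
  f x @[x --> F] --> A -> map_mx Num.conj (f x) @[x --> F] --> map_mx Num.conj A.
Proof.
move=> fA; apply: cvg_mxP => i j; under eq_fun do rewrite mxE; rewrite mxE.
by apply: cvg_conj; apply: cvg_coord.
Qed.

Lemma cvg_trmx T (F : set_system T) {FF : Filter F} m n
    (f : T -> 'M[C]_(m, n)) (A : 'M[C]_(m, n)) :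
  f x @[x --> F] --> A -> (f x)^T @[x --> F] --> A^T.
Proof.
move=> fA; apply: cvg_mxP => i j; under eq_fun do rewrite mxE; rewrite mxE.
exact: cvg_coord.
Qed.

Lemma cvg_mxtrace T (F : set_system T) {FF : Filter F} n (f : T -> 'M[C]_n) (A : 'M[C]_n) :
  f x @[x --> F] --> A -> \tr (f x) @[x --> F] --> \tr A.
Proof. by move=> fA; apply: cvg_sum_ord => i; apply: cvg_coord. Qed.

Lemma cvg_scalar_mx T (F : set_system T) {FF : Filter F} n (f : T -> C) (l : C) :
  f x @[x --> F] --> l -> (f x)%:M @[x --> F] --> (l%:M : 'M[C]_n).
Proof.
move=> fl; apply: cvg_mxP => i j; under eq_fun do rewrite mxE; rewrite mxE.
by apply: cvgMn.
Qed.

Lemma continuous_id_mx m n : continuous (fun X : 'M[C]_(m, n) => X).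
Proof. by move=> X P HP; apply: HP. Qed.

Lemma continuous_mulmxl m n p (B : 'M[C]_(n, p)) : continuous (fun X : 'M[C]_(m, n) => X *m B).
Proof. by move=> X; apply: (@cvg_mulmx _ (nbhs X)); [apply: continuous_id_mx|apply: cvg_cst]. Qed.

Lemma continuous_iota N : continuous (fun X : 'M[C]_N => iota X).
Proof.
move=> X; apply: (@cvg_mxP _ (nbhs X)) => i j; rewrite /Defs.iota.
under eq_fun do rewrite /block_mx mxE; rewrite /block_mx mxE.
case: (fintype.split i) => i'; under eq_fun do rewrite mxE; rewrite mxE;
  case: (fintype.split j) => j'.
- exact: coord_continuous.
- by under eq_fun do rewrite mxE; rewrite mxE; apply: cvg_cst.
- by under eq_fun do rewrite mxE; rewrite mxE; apply: cvg_cst.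
- under eq_fun do rewrite mxE; rewrite mxE.
  by apply: cvg_conj; apply: coord_continuous.
Qed.

Lemma continuous_ulsubmx m1 m2 n1 n2 : continuous (fun X : 'M[C]_(m1 + m2, n1 + n2) => ulsubmx X).
Proof.
move=> X; apply: (@cvg_mxP _ (nbhs X)) => i j; under eq_fun do rewrite !mxE; rewrite !mxE.
exact: coord_continuous.
Qed.

Lemma continuous_ursubmx m1 m2 n1 n2 : continuous (fun X : 'M[C]_(m1 + m2, n1 + n2) => ursubmx X).
Proof.
move=> X; apply: (@cvg_mxP _ (nbhs X)) => i j; under eq_fun do rewrite !mxE; rewrite !mxE.
exact: coord_continuous.
Qed.

Lemma closed_preimage (S T : topologicalType) (f : S -> T) (A : set T) :
  continuous f -> closed A -> closed (f @^-1` A).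
Proof. by move=> cf cA; apply: closed_comp => // x _; apply: cf. Qed.

Lemma closed_mx1 m n (A : 'M[C]_(m, n)) : closed [set A].
Proof. by apply: accessible_closed_set1; apply: hausdorff_accessible; apply: norm_hausdorff. Qed.

Lemma closed_mxeq (T : topologicalType) m n (f g : T -> 'M[C]_(m, n)) :
  continuous f -> continuous g -> closed [set x | f x = g x].
Proof.
move=> cf cg; have -> : [set x | f x = g x] = (fun x => f x - g x) @^-1` [set 0].
  by apply/seteqP; split=> x /= => [->|/subr0_eq//]; rewrite subrr.
apply: closed_preimage; last exact: closed_mx1.
by move=> x; apply: cvgB; [apply: cf|apply: cg].
Qed.

(** iota L is the set of matrices Y whose upper left block lies in L and
    determines Y. *)
Lemma closed_iota N (L : set 'M[C]_N) : closed L -> closed (iota @` L).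
Proof.
move=> cL; have -> : iota @` L = (fun Y : 'M[C]_(N + N) => ulsubmx Y) @^-1` L
    `&` [set Y | Y = iota (ulsubmx Y)].
  apply/seteqP; split=> [_ [X LX <-]|Y [LY ->]].
    by split=> /=; rewrite /Defs.iota block_mxKul.
  by exists (ulsubmx Y).
apply: closedI; first by apply: closed_preimage => //; apply: continuous_ulsubmx.
apply: closed_mxeq; first exact: continuous_id_mx.
move=> X; apply: (continuous_comp (f := fun X : 'M[C]_(N + N) => ulsubmx X)
  (g := fun X : 'M[C]_N => iota X)); first exact: continuous_ulsubmx.
exact: continuous_iota.
Qed.

Lemma ext_split N (L : set 'M[C]_N) g : g \in unitmx ->
  ext L g = iota @` L `|` (fun Y => Y *m invmx g) @^-1` (iota @` L).
Proof.
move=> ug; congr (_ `|` _); apply/seteqP; split=> [_ [X LX <-]|Y [X LX XE]].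
  by exists X => //; rewrite mulmxK.
by exists X => //; rewrite XE mulmxKV.
Qed.

Lemma closed_ext N (L : set 'M[C]_N) g : g \in unitmx -> closed L -> closed (ext L g).
Proof.
move=> ug cL; rewrite ext_split //; apply: closedU; first exact: closed_iota.
by apply: closed_preimage; [apply: continuous_mulmxl|apply: closed_iota].
Qed.

End MatrixTopology.

(** * Real coordinates on the complex numbers *)

(** The topological notions used here belong to an arbitrary closed field with
    a norm.  Compactness and the exponential also need real and imaginary parts;
    they enter only through this interface, so that the concrete field R[i] is
    never unfolded. *)
Record coordinates (R : realType) (C : numClosedFieldType) := Coordinates {
  re_of : C -> R;
  im_of : C -> R;
  complex_of : R -> R -> C;
  mkcK : forall z, complex_of (re_of z) (im_of z) = z;
  re_mkc : forall a b, re_of (complex_of a b) = a;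
  im_mkc : forall a b, im_of (complex_of a b) = b;
  mkc10 : complex_of 1 0 = 1;
  mkcB : forall a b a' b',
    complex_of a b - complex_of a' b' = complex_of (a - a') (b - b');
  mkcM : forall a b a' b',
    complex_of a b * complex_of a' b' =
    complex_of (a * a' - b * b') (a * b' + b * a');
  norm_mkc : forall a b,
    `|complex_of a b| = complex_of (Num.sqrt (a ^+ 2 + b ^+ 2)) 0;
  le_mkc : forall a b a' b',
    (complex_of a b <= complex_of a' b') = (b' == b) && (a <= a')
}.

Lemma complex_coordinates (R : realType) : coordinates R (R[i] : numClosedFieldType).
Proof.
exists (@complex.Re R) (@complex.Im R) (@Complex R) => //.
all: by case.
Qed.

Section ComplexTopology.
Variables (R : realType) (C : numClosedFieldType) (cc : coordinates R C).
Local Notation re := (re_of cc).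
Local Notation im := (im_of cc).
Local Notation mkc := (complex_of cc).

Lemma mkc00 : mkc 0 0 = 0.
Proof. by rewrite -(subrr 1) -mkcB subrr. Qed.

Lemma mkcN a b : - mkc a b = mkc (- a) (- b).
Proof. by rewrite -sub0r -mkc00 mkcB !sub0r. Qed.

Lemma mkcD a b a' b' : mkc a b + mkc a' b' = mkc (a + a') (b + b').
Proof. by rewrite -[mkc a' b']opprK mkcN mkcB !opprK. Qed.

Lemma reB (z w : C) : re (z - w) = re z - re w.
Proof. by rewrite -{1}(mkcK cc z) -{1}(mkcK cc w) mkcB re_mkc. Qed.

Lemma le_mkc0 (a b : R) : (mkc a 0 <= mkc b 0) = (a <= b).
Proof. by rewrite le_mkc eqxx. Qed.

Lemma lt_mkc0 (a b : R) : (mkc a 0 < mkc b 0) = (a < b).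
Proof.
rewrite !lt_def le_mkc0; congr (~~ _ && _); apply/eqP/eqP => [|->//].
by move/(congr1 re); rewrite !re_mkc.
Qed.

Lemma conj_mkc a b : (mkc a b)^* = mkc a (- b).
Proof.
have [z0|z0] := eqVneq (mkc a b) 0.
  have a0 : a = 0 by rewrite -(re_mkc cc a b) z0 -mkc00 re_mkc.
  have b0 : b = 0 by rewrite -(im_mkc cc a b) z0 -mkc00 im_mkc.
  by rewrite a0 b0 oppr0 mkc00 conjC0.
apply: (mulfI z0); rewrite -normCK norm_mkc expr2 !mkcM.
rewrite !mulr0 mul0r subr0 addr0 -expr2 sqr_sqrtr ?addr_ge0 ?sqr_ge0 //.
by rewrite !mulrN opprK -!expr2 [b * a]mulrC addNr.
Qed.

Lemma le_mkc1 a : (mkc a 0 <= 1) = (a <= 1).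
Proof. by rewrite -(mkc10 cc) le_mkc0. Qed.

Lemma ltc0P (e : C) : 0 < e -> exists2 r : R, 0 < r & e = mkc r 0.
Proof.
rewrite -(mkcK cc e) -mkc00; set a := re e; set b := im e => e0.
have : mkc 0 0 <= mkc a b by exact: ltW.
rewrite le_mkc => /andP[/eqP b0 _]; rewrite b0 lt_mkc0 in e0 *.
by exists a.
Qed.

Lemma norm_le_mkc (a b : R) : `|mkc a b| <= mkc (`|a| + `|b|) 0.
Proof.
rewrite norm_mkc le_mkc0 -[leRHS]ger0_norm ?addr_ge0 // -sqrtr_sqr.
rewrite ler_sqrt ?sqr_ge0 // sqrrD !real_normK ?num_real //.
by rewrite addrAC lerDl mulrn_wge0 // mulr_ge0.
Qed.

Lemma re_le_norm (z : C) : mkc `|re z| 0 <= `|z|.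
Proof.
rewrite -{2}(mkcK cc z) norm_mkc le_mkc0 -sqrtr_sqr.
by rewrite ler_sqrt ?addr_ge0 ?sqr_ge0 // lerDl sqr_ge0.
Qed.

Lemma im_le_norm (z : C) : mkc `|im z| 0 <= `|z|.
Proof.
rewrite -{2}(mkcK cc z) norm_mkc le_mkc0 -sqrtr_sqr.
by rewrite ler_sqrt ?addr_ge0 ?sqr_ge0 // lerDr sqr_ge0.
Qed.

Lemma cvg_mkc T (F : set_system T) {FF : Filter F} (f g : T -> R) (a b : R) :
  f x @[x --> F] --> a -> g x @[x --> F] --> b -> mkc (f x) (g x) @[x --> F] --> mkc a b.
Proof.
move=> /cvgrPdist_lt fa /cvgrPdist_lt gb; apply/cvgrPdist_lt => e /ltc0P[r r0 ->].
have r20 : 0 < r / 2 by rewrite divr_gt0.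
near=> x; rewrite mkcB; apply: le_lt_trans (norm_le_mkc _ _) _; rewrite lt_mkc0.
rewrite [r]splitr ltrD //; near: x; [exact: fa|exact: gb].
Unshelve. all: by end_near. Qed.

Lemma cvg_re T (F : set_system T) {FF : Filter F} (f : T -> C) (l : C) :
  f x @[x --> F] --> l -> re (f x) @[x --> F] --> re l.
Proof.
move=> /cvgrPdist_lt fl; apply/cvgrPdist_lt => e e0.
have e0' : (0 : C) < mkc e 0 by rewrite -mkc00 lt_mkc0.
apply: filterS (fl _ e0') => x; rewrite -reB.
by move=> /(le_lt_trans (re_le_norm _)); rewrite lt_mkc0.
Qed.

Lemma compact_unit_disc : compact [set z : C | `|z| <= 1].
Proof.
pose f (p : R * R) : C := mkc p.1 p.2.
have cD : compact (f @` (`[(-1), 1] `*` `[(-1), 1])).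
  apply: continuous_compact; last by apply: compact_setX; apply: segment_compact.
  apply: continuous_subspaceT => -[a b]; apply: (@cvg_mkc _ (nbhs (a, b))).
    exact: cvg_fst.
  exact: cvg_snd.
apply: subclosed_compact cD _.
  have -> : [set z : C | `|z| <= 1] = (fun z : C => re `|z|) @^-1` [set x | x <= 1].
    apply/seteqP; split=> z /=; rewrite -(mkcK cc z) norm_mkc re_mkc;
      by rewrite le_mkc1.
  apply: closed_preimage; last exact: closed_le.
  by move=> z; apply: (@cvg_re _ (nbhs z)); apply: norm_continuous.
move=> z /= z1; exists (re z, im z) => /=; last exact: (mkcK cc).
rewrite !in_itv /= -!ler_norml -!le_mkc1.
by split; [apply: le_trans (re_le_norm z) z1|apply: le_trans (im_le_norm z) z1].
Qed.

Lemma compact_unit_mx m n : compact [set X : 'M[C]_(m, n) | forall i j, `|X i j| <= 1].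
Proof.
pose f (v : 'rV[C]_(m * n)) : 'M[C]_(m, n) := vec_mx v.
have := @rV_compact C (m * n) (fun=> [set z : C | `|z| <= 1]) (fun=> compact_unit_disc).
move=> /(@continuous_compact _ _ f); set B := f @` _ => cB.
have -> : [set X : 'M[C]_(m, n) | forall i j, `|X i j| <= 1] = B.
  apply/seteqP; split=> [X X1|_ [v v1 <-] i j].
    exists (mxvec X); rewrite ?/f ?mxvecK // => i.
    by case/mxvec_indexP: i => i j; rewrite mxvecE; apply: X1.
  by rewrite /f mxE; apply: v1.
apply: cB; apply: continuous_subspaceT => v; apply: (@cvg_mxP _ _ (nbhs v)) => i j.
by rewrite /f; under eq_fun do rewrite mxE; rewrite mxE; apply: coord_continuous.
Qed.

Lemma unitary_entry n (X : 'M[C]_n) i j : X \is unitarymx -> `|X i j| <= 1.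
Proof.
move=> /unitarymxP/matrixP/(_ i i); rewrite !mxE eqxx.
rewrite (bigD1 j) //= !mxE -normCK => e.
rewrite -(@ler_pXn2r _ 2) ?nnegrE // expr1n -[leRHS]e lerDl sumr_ge0 // => k _.
by rewrite !mxE mul_conjC_ge0.
Qed.

Lemma compact_unitary n (K : set 'M[C]_n) : closed K -> K `<=` U n -> compact K.
Proof.
move=> cK KU; apply: subclosed_compact cK (@compact_unit_mx n n) _.
by move=> X /KU uX i j; apply: unitary_entry.
Qed.

Definition cis_of (t : R) : C := mkc (cos t) (sin t).

Local Notation cis := cis_of.

Lemma norm_cis t : `|cis t| = 1.
Proof. by rewrite norm_mkc cos2Dsin2 sqrtr1 mkc10. Qed.

Lemma cisD s t : cis (s + t) = cis s * cis t.
Proof. by rewrite /cis_of mkcM cosD sinD; congr (complex_of cc _ _); rewrite addrC. Qed.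

Lemma cis0 : cis 0 = 1. Proof. by rewrite /cis_of cos0 sin0 mkc10. Qed.

Lemma cisN t : cis (- t) = (cis t)^*.
Proof. by rewrite /cis_of cosN sinN conj_mkc. Qed.

Lemma cisMn t k : cis (t *+ k) = cis t ^+ k.
Proof. by elim: k => [|k IH]; rewrite ?mulr0n ?cis0 // mulrS exprS cisD IH. Qed.

Lemma continuous_cis : continuous cis.
Proof.
by move=> t; apply: (@cvg_mkc _ (nbhs t)); [apply: continuous_cos|apply: continuous_sin].
Qed.

Lemma cis_surj (z : C) : `|z| = 1 -> exists t, z = cis t.
Proof.
rewrite -(mkcK cc z) norm_mkc -(mkc10 cc) => /(congr1 re).
rewrite !re_mkc => /(congr1 (fun x => x ^+ 2)) /=.
set a := re z; set b := im z.
rewrite sqr_sqrtr ?addr_ge0 ?sqr_ge0 // expr1n => ab.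
have a1 : -1 <= a <= 1.
  rewrite -ler_norml -(@ler_pXn2r _ 2) ?nnegrE // expr1n real_normK ?num_real //.
  by rewrite -ab lerDl sqr_ge0.
have sb : Num.sqrt (1 - a ^+ 2) = `|b|.
  by rewrite -ab addrAC subrr add0r sqrtr_sqr.
have [b0|b0] := leP 0 b.
  by exists (acos a); rewrite /cis_of acosK // sin_acos // sb ger0_norm.
exists (- acos a); rewrite /cis_of cosN sinN acosK // sin_acos // sb.
by rewrite ltr0_norm ?opprK.
Qed.

End ComplexTopology.

(** * Identity components and connected subgroups *)
Section Components.

(** P and Q cut B into two disjoint relatively closed pieces. *)
Lemma connected_sub_closed (T : topologicalType) (B P Q : set T) :
  connected B -> closed P -> closed Q -> B `<=` P `|` Q ->
  (forall x, B x -> P x -> Q x -> False) -> B `&` P !=set0 -> B `<=` P.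
Proof.
move=> cB cP cQ BPQ disj BP0.
suff <- : B `&` P = B by move=> x [].
apply: cB => //; last by exists P.
exists (~` Q); first exact: closed_openC.
apply/seteqP; split=> x [Bx].
  by move=> Px; split=> // Qx; apply: (disj x).
by move=> nQ; split=> //; case: (BPQ x Bx).
Qed.

Lemma connected_star (T : topologicalType) (A : set T) (x : T) :
  (forall y, A y -> exists B : set T, [/\ connected B, B `<=` A, B x & B y]) ->
  connected A.
Proof.
move=> h; suff <- : connected_component A x = A by apply: component_connected.
apply/seteqP; split; first exact: connected_component_sub.
by move=> y /h[B [cB BA Bx By]]; exists B.
Qed.

Variables (C : numClosedFieldType) (N : nat).
Hypothesis N_gt0 : (0 < N)%N.

Lemma unitmx0F : ((0 : 'M[C]_N) \in unitmx) = false.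
Proof.
by case: N N_gt0 => // n _; rewrite unitmxE det0 unitr0.
Qed.

Lemma iota_not_ext (X Y : 'M[C]_N) g : X \in unitmx -> Utau g -> iota X <> iota Y *m g.
Proof.
move=> uX [Z _ <-]; rewrite mulmxA -iotaM /Defs.iota /tau mulmx_block.
rewrite !mulmx0 !mul0mx !addr0 => /eq_block_mx[X0 _ _ _].
by move: uX; rewrite X0 unitmx0F.
Qed.

(** The elements of ext L g are block diagonal or block antidiagonal, so that
    vanishing of the upper right block and vanishing of the upper left block
    are two closed conditions which cover it; both together are impossible for
    an invertible matrix. *)
Lemma idcomp_ext (L : set 'M[C]_N) g : subgroup L -> connected L -> Utau g ->
  idcomp (ext L g) = iota @` L.
Proof.
move=> [uL L1 _ _] cL gU; have ug := Utau_unit gU.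
have i1 : (iota @` L) 1%:M by exists 1%:M => //; rewrite iota1.
apply/seteqP; split; last first.
  apply: connected_component_max => //; first by move=> X; left.
  apply: connected_continuous_connected => //.
  by apply: continuous_subspaceT; apply: continuous_iota.
move=> X cX; have XH := connected_component_sub cX.
case: XH => // -[Y LY YX]; exfalso.
pose P := [set Z : 'M[C]_(N + N) | ursubmx Z = 0].
pose Q := [set Z : 'M[C]_(N + N) | ulsubmx Z = 0].
have PX : P X.
  apply: (@connected_sub_closed _ (idcomp (ext L g)) P Q) cX.
  - exact: component_connected.
  - apply: (closed_mxeq (f := fun Z : 'M[C]_(N + N) => ursubmx Z) (g := fun=> 0)).
      exact: continuous_ursubmx.
    exact: cst_continuous.
  - apply: (closed_mxeq (f := fun Z : 'M[C]_(N + N) => ulsubmx Z) (g := fun=> 0)).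
      exact: continuous_ulsubmx.
    exact: cst_continuous.
  - move=> Z /connected_component_sub[[W _ <-]|[W _ <-]]; [left|right].
      by rewrite /P /= /Defs.iota block_mxKur.
    case: gU => V _ <-; rewrite /Q /= mulmxA -iotaM /Defs.iota /tau mulmx_block.
    by rewrite !mulmx0 !mul0mx !addr0 block_mxKul.
  - move=> Z /connected_component_sub HZ; rewrite /P /Q /= => P0 Q0.
    have uZ : Z \in unitmx.
      case: HZ => -[W LW <-]; first exact/iota_unit/uL.
      by rewrite unitmx_mul ug andbT; apply/iota_unit/uL.
    move: uZ; rewrite -[Z]submxK P0 Q0 => uZ.
    have /matrixP : (row_mx (1%:M : 'M[C]_N) 0 : 'M[C]_(N, N + N)) = 0.
      apply: (can_inj (mulmxK uZ)); rewrite mul0mx mul_row_block.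
      by rewrite !mul1mx !mul0mx addr0 row_mx0.
    move=> /(_ (Ordinal N_gt0) (lshift N (Ordinal N_gt0))).
    by rewrite row_mxEl !mxE eqxx => /eqP; rewrite oner_eq0.
  - exists 1%:M; split; first by apply: connected_component_refl; left.
    by rewrite /P /= -iota1 /Defs.iota block_mxKur.
move: PX; rewrite /P /= -YX; case: gU => V uV <-.
rewrite mulmxA -iotaM /Defs.iota /tau mulmx_block !mulmx0 !mul0mx.
rewrite !add0r !addr0 !mulmx1 block_mxKur.
move=> YV0; have : Y *m V \in unitmx by rewrite unitmx_mul uL //=; apply: unitarymx_unit.
by rewrite YV0 unitmx0F.
Qed.

Lemma Utau_tau : Utau (tau C N).
Proof.
exists 1%:M; last by rewrite iota1 mul1mx.
by have [] := subgroupU C N.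
Qed.

Lemma Uext_ext : Uext N = ext (U N) (tau C N). Proof. by []. Qed.

Lemma subgroup_Uext : subgroup (Uext N : set 'M[C]_(N + N)).
Proof.
rewrite Uext_ext; apply: subgroup_ext; [exact: subgroupU|exact: tau_unit| |].
  move=> X uX; exists (map_mx Num.conj X); first by rewrite /U /= conjC_unitary.
  by rewrite -conj_tau /conjm mulmxKV // tau_unit.
by rewrite tau_sq; exists 1%:M; [have [] := subgroupU C N|rewrite iota1].
Qed.

End Components.

Section UnitaryConnected.
Variables (R : realType) (C : numClosedFieldType) (cc : coordinates R C).
Local Notation cis := (cis_of cc).

(** The spectral theorem, with the eigenvalues written as cis t: it provides
    logarithms of unitary matrices. *)
Lemma unitary_diag n (X : 'M[C]_n) : X \is unitarymx ->
  exists2 P : 'M[C]_n, P \is unitarymx &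
    exists t : 'rV[R]_n, X = invmx P *m diag_mx (\row_i cis (t 0 i)) *m P.
Proof.
move=> uX; have nX : X \is normalmx.
  apply/normalmxP; have /unitarymxP e := uX; rewrite e.
  by rewrite (mulmx1C e).
have [P [d [uP XE]]] : exists P d, P \is unitarymx /\ X = invmx P *m diag_mx d *m P.
  exists (spectralmx X), (spectral_diag X); split; first exact: spectral_unitarymx.
  exact/orthomx_spectralP.
exists P => //.
have uPm := unitarymx_unit uP.
have dX : diag_mx d = P *m X *m invmx P.
  by rewrite {1}XE !mulmxA mulmxV // mul1mx mulmxK.
have ud : diag_mx d \is unitarymx.
  rewrite dX; apply: mul_unitarymx; first exact: mul_unitarymx.
  by rewrite invmx_unitary // trmxC_unitary.
have d1 i : `|d 0 i| = 1.
  have /unitarymxP/matrixP/(_ i i) := ud; rewrite !mxE eqxx.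
  rewrite (bigD1 i) //= !mxE eqxx mulr1n -normCK big1 ?addr0.
    by move=> /eqP; rewrite sqrp_eq1 // => /eqP.
  by move=> j ji; rewrite !mxE eq_sym (negPf ji) mul0r.
have [t td] := choice (fun i => cis_surj cc (d1 i)).
exists (\row_i t i); rewrite {1}XE; congr (_ *m diag_mx _ *m _).
by apply/rowP => i; rewrite !mxE td.
Qed.

Lemma diag_unitary n (P : 'M[C]_n) (t : 'rV[R]_n) : P \is unitarymx ->
  invmx P *m diag_mx (\row_i cis (t 0 i)) *m P \is unitarymx.
Proof.
move=> uP; apply: mul_unitarymx => //; apply: mul_unitarymx.
  by rewrite invmx_unitary // trmxC_unitary.
apply/unitarymxP; rewrite tr_diag_mx map_diag_mx mulmx_diag.
apply/matrixP => i j; rewrite !mxE; case: eqP => // _.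
by rewrite -normCK norm_cis expr1n.
Qed.

Lemma cvg_diag T (F : set_system T) {FF : Filter F} n (f : T -> 'rV[C]_n) (l : 'rV[C]_n) :
  f x @[x --> F] --> l -> diag_mx (f x) @[x --> F] --> diag_mx l.
Proof.
move=> fl; apply: cvg_mxP => i j; under eq_fun do rewrite mxE; rewrite mxE.
by apply: cvgMn; apply: cvg_coord.
Qed.

(** The path s -> P^-1 diag(cis (s t)) P joins 1 to a unitary matrix. *)
Lemma connected_U n : connected (U n : set 'M[C]_n).
Proof.
apply: (connected_star (x := (1%:M : 'M[C]_n))) => X uX.
have [P uP [t ->]] := unitary_diag uX.
pose f (s : R) := invmx P *m diag_mx (\row_i cis (s * t 0 i)) *m P.
exists (range f); split.
- apply: connected_continuous_connected; first by apply/connected_intervalP.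
  apply: continuous_subspaceT => s.
  apply: (@cvg_mulmx _ _ (nbhs s)); last exact: cvg_cst.
  apply: (@cvg_mulmx _ _ (nbhs s)); first exact: cvg_cst.
  apply: cvg_diag; apply: cvg_mxP => i j; under eq_fun do rewrite mxE; rewrite mxE.
  apply: (cvg_comp (fun s : R => s * t 0 j) cis); last exact: continuous_cis.
  by apply: cvgM; [exact: cvg_id|exact: cvg_cst].
- move=> _ [s _ <-]; have := diag_unitary (s *: t) uP.
  by rewrite /U /= /f; under eq_mx do rewrite mxE.
- exists 0 => //; rewrite /f.
  have -> : \row_i cis (0 * t 0 i) = const_mx 1.
    by apply/rowP => i; rewrite !mxE mul0r cis0.
  by rewrite diag_const_mx mulmx1 mulVmx // unitarymx_unit.
- by exists 1 => //; rewrite /f; under eq_mx do rewrite mul1r.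
Qed.

Lemma connected_with_scalars n (K : set 'M[C]_n) :
  subgroup K -> connected K -> connected (with_scalars K).
Proof.
move=> [_ K1 _ _] cK.
apply: (connected_star (x := (1%:M : 'M[C]_n))) => _ [X KX [_ [z /= z1 <-] <-]].
have [t ->] := cis_surj cc z1.
pose f (s : R) := X *m (cis s)%:M.
exists (K `|` range f); split.
- apply: connectedU => //.
    by exists X; split => //; exists 0 => //; rewrite /f cis0 mulmx1.
  apply: connected_continuous_connected; first by apply/connected_intervalP.
  apply: continuous_subspaceT => s.
  apply: (@cvg_mulmx _ _ (nbhs s)); first exact: cvg_cst.
  by apply: cvg_scalar_mx; apply: continuous_cis.
- move=> Y [KY|[s _ <-]]; first exact: sub_with_scalars.
  by exists X => //; exists (cis s)%:M => //; exists (cis s) => //=; rewrite norm_cis.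
- by left.
- by right; exists t.
Qed.

Lemma closed_unit_scalars n : closed (@unit_scalars C n).
Proof.
case: n => [|n].
  have -> : @unit_scalars C 0 = setT.
    apply/seteqP; split=> // X _; exists 1; rewrite /= ?normr1 //.
    by apply/matrixP => -[].
  exact: closedT.
have -> : @unit_scalars C n.+1 = [set X : 'M[C]_n.+1 | X = (X 0 0)%:M] `&`
    (fun X : 'M[C]_n.+1 => `|X 0 0|) @^-1` [set 1].
  apply/seteqP; split=> [_ [z /= z1 <-]|X [XE X1]].
    by split; rewrite /= !mxE eqxx mulr1n.
  by exists (X 0 0).
apply: closedI.
  apply: closed_mxeq; first exact: continuous_id_mx.
  by move=> X; apply: (@cvg_scalar_mx _ _ (nbhs X)); apply: coord_continuous.
apply: closed_preimage.
  by move=> X; apply: (@cvg_norm _ _ _ (nbhs X)); apply: coord_continuous.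
by apply: accessible_closed_set1; apply: hausdorff_accessible; apply: norm_hausdorff.
Qed.

Lemma closed_with_scalars n (K : set 'M[C]_n) : closed K -> K `<=` U n -> closed (with_scalars K).
Proof.
move=> cK KU; apply: compact_closed; first exact: norm_hausdorff.
have -> : with_scalars K = (fun p : 'M[C]_n * 'M[C]_n => p.1 *m p.2) @` (K `*` @unit_scalars C n).
  apply/seteqP; split=> [_ [X KX [z Tz <-]]|_ [[X z] [/= KX Tz] <-]].
    by exists (X, z).
  by exists X => //; exists z.
apply: continuous_compact.
  apply: continuous_subspaceT => -[X Y].
  by apply: (@cvg_mulmx _ _ (nbhs (X, Y))); [exact: cvg_fst|exact: cvg_snd].
apply: compact_setX; first exact: (compact_unitary cc).
by apply: (compact_unitary cc); [exact: closed_unit_scalars|exact: unit_scalars_U].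
Qed.

End UnitaryConnected.

(** * The matrix exponential and inner automorphisms *)
Section Exponential.
Variables (R : realType) (C : numClosedFieldType) (cc : coordinates R C).
Local Notation cis := (cis_of cc).
Local Notation mkc := (complex_of cc).
Local Notation re := (re_of cc).

Lemma natr_mkc k : k%:R = mkc k%:R 0.
Proof. by elim: k => [|k IH]; rewrite ?mkc00 // -addn1 !natrD IH -(mkc10 cc) mkcD addr0. Qed.

Lemma invr_mkc a : a != 0 -> (mkc a 0)^-1 = mkc a^-1 0.
Proof.
move=> a0; have z0 : mkc a 0 != 0.
  by apply: contra_neq a0 => /(congr1 re); rewrite -(mkc00 cc) !re_mkc.
apply: (mulfI z0); rewrite mulfV // mkcM !mulr0 mul0r subr0 addr0 mulfV //.
by rewrite mkc10.
Qed.

Lemma imag_expr t k : mkc 0 t ^+ k =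
  mkc ((~~ odd k)%:R * (-1) ^+ k./2 * t ^+ k) ((odd k)%:R * (-1) ^+ k.-1./2 * t ^+ k).
Proof.
elim: k => [|k IH]; first by rewrite /= !expr0 !mulr1 mkc10.
rewrite exprS IH mkcM /= !mul0r sub0r add0r negbK.
congr (complex_of cc _ _).
  case: (boolP (odd k)) => [ok|_] /=; last by rewrite !mul0r mulr0 oppr0.
  rewrite !mul1r exprS mulrCA -mulNr; congr (_ * _).
  by case: k ok {IH} => // k /= ok; rewrite exprS mulN1r.
case: (boolP (odd k)) => [ok|_] /=; first by rewrite !mul0r mulr0.
by rewrite !mul1r exprS mulrCA.
Qed.

Lemma mkc0B a b : mkc 0 (a - b) = mkc 0 a - mkc 0 b.
Proof. by rewrite mkcB subrr. Qed.

Definition expterm (z : C) k := (k`!)%:R^-1 * z ^+ k.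

Lemma expterm_imag t k : expterm (mkc 0 t) k = mkc (cos_coeff t k) (sin_coeff t k).
Proof.
rewrite /expterm natr_mkc invr_mkc ?pnatr_eq0 -?lt0n ?fact_gt0 //.
rewrite imag_expr mkcM !mul0r subr0 addr0 /cos_coeff /sin_coeff /=.
by congr (complex_of cc _ _); rewrite mulrC.
Qed.

Lemma sum_mkc (a b : nat -> R) n :
  \sum_(0 <= k < n) mkc (a k) (b k) = mkc (\sum_(0 <= k < n) a k) (\sum_(0 <= k < n) b k).
Proof.
elim: n => [|n IH]; first by rewrite !big_geq // mkc00.
by rewrite !big_nat_recr //= IH mkcD.
Qed.

Lemma cvg_expterm t : series (expterm (mkc 0 t)) n @[n --> \oo] --> cis t.
Proof.
have -> : (fun n => series (expterm (mkc 0 t)) n) =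
    (fun n => mkc (series (cos_coeff t) n) (series (sin_coeff t) n)).
  apply/funext => n; rewrite /series /= -sum_mkc.
  by apply: eq_bigr => k _; rewrite expterm_imag.
apply: cvg_mkc.
  by have := @is_cvg_series_cos_coeff R t; rewrite cos.unlock.
by have := @is_cvg_series_sin_coeff R t; rewrite sin.unlock.
Qed.

Lemma mx_conj_expr n (P D : 'M[C]_n) k : P \in unitmx ->
  (invmx P *m D *m P) ^+ k = invmx P *m D ^+ k *m P.
Proof.
move=> uP; elim: k => [|k IH]; first by rewrite !expr0 mulmx1 mulVmx.
rewrite !exprS IH -!mulmxE -!mulmxA; congr (_ *m (_ *m _)).
by rewrite mulmxA mulmxV // mul1mx.
Qed.

Lemma diag_expr n (d : 'rV[C]_n) k : diag_mx d ^+ k = diag_mx (\row_i d 0 i ^+ k).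
Proof.
elim: k => [|k IH]; first by rewrite expr0; apply/matrixP => i j; rewrite !mxE expr0.
rewrite exprS IH -mulmxE mulmx_diag; congr diag_mx.
by apply/rowP => i; rewrite !mxE exprS.
Qed.

Lemma mexp_diag n (P : 'M[C]_n) (t : 'rV[R]_n) : P \in unitmx ->
  mexp (invmx P *m diag_mx (\row_i mkc 0 (t 0 i)) *m P) =
  invmx P *m diag_mx (\row_i cis (t 0 i)) *m P.
Proof.
move=> uP; apply: cvg_lim; first exact: norm_hausdorff.
set D := diag_mx _.
have -> : series (fun k : nat => (k`!)%:R^-1 *: (invmx P *m D *m P) ^+ k) =
   (fun n => invmx P *m diag_mx (\row_i series (expterm (mkc 0 (t 0 i))) n) *m P).
  apply/funext => m; rewrite /series /=.
  have -> : \sum_(0 <= k < m) (k`!)%:R^-1 *: (invmx P *m D *m P) ^+ k =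
     invmx P *m (\sum_(0 <= k < m) (k`!)%:R^-1 *: D ^+ k) *m P.
    rewrite mulmx_sumr mulmx_suml; apply: eq_bigr => k _.
    by rewrite mx_conj_expr // -scalemxAr -scalemxAl.
  congr (_ *m _ *m _); apply/matrixP => i j.
  rewrite summxE !mxE -sumrMnl; apply: eq_bigr => k _.
  by rewrite /D diag_expr !mxE mulrnAr.
apply: cvg_mulmx; last exact: cvg_cst.
apply: cvg_mulmx; first exact: cvg_cst.
apply: cvg_diag; apply: cvg_mxP => i j; under eq_fun do rewrite mxE; rewrite mxE.
exact: cvg_expterm.
Qed.

(** This is exp (ad X) = Ad (exp X): in the basis P where X is diagonal with
    entries i t_a, the operator ad X multiplies the entry (a, b) by
    i (t_a - t_b). *)
Lemma exp_ad_diag n (P : 'M[C]_n) (t : 'rV[R]_n) Y : P \in unitmx ->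
  exp_ad (invmx P *m diag_mx (\row_i mkc 0 (t 0 i)) *m P) Y =
  conjm (invmx P *m diag_mx (\row_i cis (t 0 i)) *m P) Y.
Proof.
move=> uP; pose Z := P *m Y *m invmx P; set X := invmx P *m _ *m P.
have XE k : iter k (lieb X) Y =
    invmx P *m (\matrix_(i, j) (mkc 0 (t 0 i - t 0 j) ^+ k * Z i j)) *m P.
  elim: k => [|k /= ->].
    have -> : \matrix_(i, j) (mkc 0 (t 0 i - t 0 j) ^+ 0 * Z i j) = Z.
      by apply/matrixP => i j; rewrite mxE expr0 mul1r.
    by rewrite /Z !mulmxA mulVmx // mul1mx mulmxKV.
  rewrite /lieb /X; set D := diag_mx _; set W := \matrix_(i, j) _.
  have e A B : invmx P *m A *m P *m (invmx P *m B *m P) = invmx P *m (A *m B) *m P.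
    by rewrite -!mulmxA; congr (_ *m (_ *m _)); rewrite !mulmxA mulmxV // mul1mx.
  rewrite !e -mulmxBl -mulmxBr; congr (_ *m _ *m _).
  apply/matrixP => i j; rewrite mxE [in RHS]mxE mul_diag_mx mul_mx_diag !mxE.
  by rewrite exprS mkc0B; ring.
have ux : diag_mx (\row_i cis (t 0 i)) *m diag_mx (\row_i cis (- t 0 i)) = 1%:M :> 'M[C]_n.
  rewrite mulmx_diag; apply/matrixP => i j; rewrite !mxE.
  by rewrite -cisD subrr cis0.
have -> : conjm (invmx P *m diag_mx (\row_i cis (t 0 i)) *m P) Y =
    invmx P *m (\matrix_(i, j) (cis (t 0 i - t 0 j) * Z i j)) *m P.
  have -> : \matrix_(i, j) (cis (t 0 i - t 0 j) * Z i j) =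
    diag_mx (\row_i cis (t 0 i)) *m Z *m diag_mx (\row_i cis (- t 0 i)).
    apply/matrixP => i j; rewrite mul_diag_mx mul_mx_diag !mxE cisD.
    by rewrite mulrAC.
  have [ud _] := mulmx1_unit ux.
  have ug : invmx P *m diag_mx (\row_i cis (t 0 i)) *m P \in unitmx.
    by rewrite !unitmx_mul unitmx_inv uP ud.
  apply: (can_inj (mulmxK ug)); rewrite /conjm mulmxKV //.
  rewrite /Z -!mulmxA; congr (_ *m (_ *m (_ *m _))).
  rewrite (mulmxA P (invmx P)) mulmxV // mul1mx.
  by rewrite (mulmxA (diag_mx _) (diag_mx _)) (mulmx1C ux) mul1mx mulVmx // mulmx1.
apply: cvg_lim; first exact: norm_hausdorff.
have -> : series (fun k : nat => (k`!)%:R^-1 *: iter k (lieb X) Y) =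
   (fun n => invmx P *m
     (\matrix_(i, j) (series (expterm (mkc 0 (t 0 i - t 0 j))) n * Z i j)) *m P).
  apply/funext => m; rewrite /series /=.
  under eq_bigr do rewrite XE scalemxAl scalemxAr.
  rewrite -mulmx_suml -mulmx_sumr.
  congr (_ *m _ *m _); apply/matrixP => i j.
  rewrite summxE !mxE mulr_suml; apply: eq_bigr => k _.
  by rewrite !mxE mulrA.
apply: cvg_mulmx; last exact: cvg_cst.
apply: cvg_mulmx; first exact: cvg_cst.
apply: cvg_mxP => i j; under eq_fun do rewrite mxE; rewrite mxE.
by apply: cvgM; [exact: cvg_expterm|exact: cvg_cst].
Qed.

Lemma exp_ad_fixed n (X Y : 'M[C]_n) : lieb X Y = 0 -> exp_ad X Y = Y.
Proof.
move=> XY0; apply: cvg_lim; first exact: norm_hausdorff.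
rewrite -(cvg_shiftS (series _)) /=.
have -> : (fun n => series (fun k : nat => (k`!)%:R^-1 *: iter k (lieb X) Y) n.+1) = fun=> Y.
  apply/funext => m; rewrite /series /= big_nat_recl // big1 ?addr0.
    by rewrite invr1 scale1r.
  move=> k _; rewrite -[k.+1]addn1 iterD /= XY0.
  suff -> : iter k (lieb X) 0 = 0 by rewrite scaler0.
  by elim: k => //= k ->; rewrite /lieb mulmx0 mul0mx subrr.
exact: cvg_cst.
Qed.

Variable N : nat.

Lemma iota_diag (Q : 'M[C]_N) (d : 'rV[C]_N) : Q \in unitmx ->
  iota (invmx Q *m diag_mx d *m Q) =
  invmx (iota Q) *m diag_mx (row_mx d (map_mx Num.conj d)) *m iota Q.
Proof.
by move=> uQ; rewrite !iotaM iotaV // diag_mx_row /Defs.iota map_diag_mx.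
Qed.

Lemma iota_diag_imag (Q : 'M[C]_N) (t : 'rV[R]_N) : Q \in unitmx ->
  iota (invmx Q *m diag_mx (\row_i mkc 0 (t 0 i)) *m Q) =
  invmx (iota Q) *m diag_mx (\row_i mkc 0 ((row_mx t (- t)) 0 i)) *m iota Q.
Proof.
move=> uQ; rewrite iota_diag //; congr (_ *m diag_mx _ *m _).
apply/rowP => i; rewrite !mxE; case: (fintype.split i) => j; rewrite !mxE //.
by rewrite conj_mkc.
Qed.

Lemma iota_diag_cis (Q : 'M[C]_N) (t : 'rV[R]_N) : Q \in unitmx ->
  iota (invmx Q *m diag_mx (\row_i cis (t 0 i)) *m Q) =
  invmx (iota Q) *m diag_mx (\row_i cis ((row_mx t (- t)) 0 i)) *m iota Q.
Proof.
move=> uQ; rewrite iota_diag //; congr (_ *m diag_mx _ *m _).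
apply/rowP => i; rewrite !mxE; case: (fintype.split i) => j; rewrite !mxE //.
by rewrite cisN.
Qed.

Lemma real_mkc (z : C) : z \is Num.real -> z = mkc (re z) 0.
Proof.
rewrite realE -(mkc00 cc) -{1 2}(mkcK cc z) !le_mkc => /orP[]/andP[/eqP e _].
  by rewrite -{1}(mkcK cc z) e.
by rewrite -{1}(mkcK cc z) -e.
Qed.

(** Every skew-Hermitian matrix Q^-1 diag(i t) Q gives an element of Lie(G),
    since its exponential is unitary. *)
Lemma lie_iota_diag (Q : 'M[C]_N) (t : 'rV[R]_N) : Q \is unitarymx ->
  lie (Uext N) (iota (invmx Q *m diag_mx (\row_i mkc 0 (t 0 i)) *m Q)).
Proof.
move=> uQ r rr; have uQm := unitarymx_unit uQ.
have -> : r *: iota (invmx Q *m diag_mx (\row_i mkc 0 (t 0 i)) *m Q) =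
    iota (invmx Q *m diag_mx (\row_i mkc 0 ((re r *: t) 0 i)) *m Q).
  have -> : \row_i mkc 0 ((re r *: t) 0 i) = r *: \row_i mkc 0 (t 0 i).
    apply/rowP => i; rewrite !mxE {2}(real_mkc rr) mkcM mulr0 mul0r subr0.
    by rewrite mul0r addr0.
  rewrite linearZ /= -scalemxAr -scalemxAl /Defs.iota scale_block_mx !scaler0.
  by rewrite map_mxZ /= (CrealP rr).
rewrite iota_diag_imag // mexp_diag ?iota_unit // -iota_diag_cis //.
left; exists (invmx Q *m diag_mx (\row_i cis ((re r *: t) 0 i)) *m Q) => //.
exact: diag_unitary.
Qed.

Lemma exp_ad_iota (Q : 'M[C]_N) (t : 'rV[R]_N) Y : Q \is unitarymx ->
  exp_ad (iota (invmx Q *m diag_mx (\row_i mkc 0 (t 0 i)) *m Q)) Y =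
  conjm (iota (invmx Q *m diag_mx (\row_i cis (t 0 i)) *m Q)) Y.
Proof.
move=> uQ; have uQm := unitarymx_unit uQ.
by rewrite iota_diag_imag // exp_ad_diag ?iota_unit // -iota_diag_cis.
Qed.

End Exponential.

(** * The Lie algebra of G and the order of Ad(g0) in Out(g) *)
Section ExponentialEstimate.
Variables (R : realType) (C : numClosedFieldType) (cc : coordinates R C).
Local Notation mkc := (complex_of cc).
Local Notation re := (re_of cc).
Local Notation im := (im_of cc).

Lemma norm_re (z : C) : `|z| = mkc (re `|z|) 0.
Proof. by apply: real_mkc; rewrite ger0_real. Qed.

Lemma cvg_mkc_series (a : nat -> C) (b : nat -> R) :
  (forall k, `|a k| <= mkc (b k) 0) -> cvg (series b @ \oo) -> cvg (series a @ \oo).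
Proof.
move=> ab cb.
have b0 k : 0 <= b k by rewrite -(le_mkc0 cc) mkc00; apply: le_trans _ (ab k).
have cr (f : C -> R) : (forall z, mkc `|f z| 0 <= `|z|) -> cvg (series (f \o a) @ \oo).
  move=> fz; apply: normed_cvg; apply: (series_le_cvg _ b0 _ cb) => k /=; first exact: normr_ge0.
  by rewrite -(le_mkc0 cc); apply: le_trans (fz _) (ab k).
have c1 := cr re (re_le_norm cc); have c2 := cr im (im_le_norm cc).
apply/cvg_ex; exists (mkc (limn (series (re \o a))) (limn (series (im \o a)))).
have -> : series a = (fun n => mkc (series (re \o a) n) (series (im \o a) n)).
  apply/funext => n; rewrite /series /= -sum_mkc.
  by apply: eq_bigr => k _; rewrite /= mkcK.
by apply: cvg_mkc.
Qed.

Lemma mx_pow_bound n (X : 'M[C]_n) k i j :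
  `|(X ^+ k) i j| <= (\sum_a \sum_b `|X a b|) ^+ k.
Proof.
elim: k i j => [|k IH] i j.
  by rewrite !expr0 mxE; case: eqP; rewrite ?normr1 ?normr0.
rewrite !exprSr -mulmxE mxE; apply: le_trans (ler_norm_sum _ _ _) _.
apply: le_trans (_ : \sum_l (\sum_a \sum_b `|X a b|) ^+ k * `|X l j| <= _).
  by apply: ler_sum => l _; rewrite normrM ler_wpM2r.
rewrite -mulr_sumr ler_wpM2l ?exprn_ge0 ?sumr_ge0 //.
  by move=> a _; apply: sumr_ge0.
apply: ler_sum => a _; rewrite (bigD1 j) //= lerDl; exact: sumr_ge0.
Qed.

Lemma scalemx_expr n (c : C) (X : 'M[C]_n) k : (c *: X) ^+ k = c ^+ k *: X ^+ k.
Proof.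
elim: k => [|k IH]; first by rewrite !expr0 scale1r.
by rewrite !exprS IH -!mulmxE -scalemxAl -scalemxAr scalerA.
Qed.

Lemma norm_mkc0 a : `|mkc a 0| = mkc `|a| 0.
Proof. by rewrite norm_mkc expr0n addr0 sqrtr_sqr. Qed.

Lemma norm_lim_le (u : nat -> C) (l : C) (B : R) :
  u n @[n --> \oo] --> l -> (\forall n \near \oo, `|u n| <= mkc B 0) -> `|l| <= mkc B 0.
Proof.
move=> /cvg_norm cu uB; have ul : re `|u n| @[n --> \oo] --> re `|l| by apply: cvg_re.
rewrite norm_re le_mkc0.
apply: (cvgr_to_le ul).
by apply: filterS uB => n h; rewrite -(le_mkc0 cc) -norm_re.
Qed.

(** The terms of order at least 2 are dominated by t^2 times the exponential
    series of b, where b is the sum of the norms of the entries of X. *)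
Lemma mexp_estimate n (X : 'M[C]_n) : exists c : R, forall t : R, `|t| <= 1 ->
  forall i j, `|(mexp (mkc t 0 *: X) - 1%:M - mkc t 0 *: X) i j| <= mkc (t ^+ 2 * c) 0.
Proof.
pose S : C := \sum_a \sum_b `|X a b|.
have S0 : 0 <= S by apply: sumr_ge0 => a _; apply: sumr_ge0.
pose b := re S; have Sb : S = mkc b 0 by apply: real_mkc; rewrite ger0_real.
have b0 : 0 <= b by rewrite -(le_mkc0 cc) mkc00 -Sb.
exists (expR b) => t t1 i j.
have mkc0X a k : mkc a 0 ^+ k = mkc (a ^+ k) 0.
  elim: k => [|k IH]; first by rewrite !expr0 mkc10.
  by rewrite !exprS IH mkcM !mulr0 mul0r subr0 addr0.
pose a (p q : 'I_n) k := (k`!%:R)^-1 * ((mkc t 0 *: X) ^+ k) p q.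
have aE p q k : a p q k = mkc (t ^+ k) 0 * ((k`!%:R)^-1 * (X ^+ k) p q).
  by rewrite /a -mkc0X scalemx_expr mxE; ring.
have nk k : (k`!%:R : C)^-1 = mkc (k`!%:R)^-1 0.
  by rewrite (natr_mkc cc) invr_mkc // pnatr_eq0 -lt0n fact_gt0.
have aB p q k : `|a p q k| <= mkc (`|t| ^+ k * exp_coeff b k) 0.
  rewrite aE !normrM nk !norm_mkc0 normrX.
  rewrite (ger0_norm (_ : 0 <= k`!%:R^-1)) ?invr_ge0 //.
  have -> : mkc (`|t| ^+ k * exp_coeff b k) 0 =
      mkc (`|t| ^+ k) 0 * (mkc k`!%:R^-1 0 * mkc (b ^+ k) 0).
    by rewrite !mkcM !(mulr0, mul0r, subr0, addr0) /exp_coeff /= [k`!%:R^-1 * _]mulrC.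
  rewrite !ler_wpM2l -?(mkc00 cc) ?le_mkc0 ?exprn_ge0 ?invr_ge0 //.
  by rewrite -mkc0X -Sb; apply: mx_pow_bound.
have a_cvg p q : cvg (series (a p q) @ \oo).
  apply: (@cvg_mkc_series _ (exp_coeff b)); last exact: is_cvg_series_exp_coeff.
  move=> k; apply: le_trans (aB p q k) _; rewrite le_mkc0 ler_piMl //.
    by rewrite /exp_coeff /= divr_ge0 // exprn_ge0.
  by rewrite exprn_ile1.
have -> : mexp (mkc t 0 *: X) = \matrix_(p, q) limn (series (a p q)).
  apply: cvg_lim; first exact: norm_hausdorff.
  apply: cvg_mxP => p q; rewrite mxE.
  rewrite (_ : (fun x => _) = series (a p q)); first exact: a_cvg.
  apply/funext => m; rewrite /series /= summxE; apply: eq_bigr => k _.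
  by rewrite mxE.
have al : series (a i j) x @[x --> \oo] --> limn (series (a i j)) by exact: a_cvg.
have := norm_lim_le (u := fun m => series (a i j) m - (1%:M : 'M[C]_n) i j - (mkc t 0 *: X) i j)
  (B := t ^+ 2 * expR b) (cvgB (cvgB al (cvg_cst _)) (cvg_cst _)).
rewrite !mxE; apply.
exists 2%N => // m /= m2; rewrite /series /=.
rewrite (big_cat_nat (n := 2)) //= big_nat_recl // big_nat1 /a expr0 expr1.
rewrite invr1 !mul1r mxE; set A := (i == j)%:R; set B := (X i j).
rewrite (_ : _ - _ - _ = \sum_(2 <= k < m) a i j k); last first.
  rewrite mxE -/B -/(\sum_(2 <= k < m) a i j k).
  by move: (\sum_(2 <= k < m) a i j k) (mkc t 0) A B => W T A' B'; ring.
apply: le_trans (ler_norm_sum _ _ _) _.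
apply: le_trans (_ : \sum_(2 <= k < m) mkc (t ^+ 2 * exp_coeff b k) 0 <= _).
  rewrite !big_nat; apply: ler_sum => k /andP[k2 _]; apply: le_trans (aB _ _ _) _.
  rewrite le_mkc0 ler_wpM2r //; first by rewrite /exp_coeff /= divr_ge0 // exprn_ge0.
  by rewrite -real_normK ?num_real // ler_wiXn2l.
have sumE (f : nat -> R) p q : \sum_(p <= k < q) mkc (f k) 0 = mkc (\sum_(p <= k < q) f k) 0.
  apply/esym/(big_morph (fun x => mkc x 0)); last exact: mkc00.
  by move=> x y; rewrite mkcD addr0.
rewrite sumE le_mkc0 -mulr_sumr ler_wpM2l ?sqr_ge0 //.
apply: le_trans (_ : series (exp_coeff b) m <= _).
  rewrite /series /= [leRHS](big_cat_nat (n := 2)) //= lerDr sumr_ge0 // => k _.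
  by rewrite /exp_coeff /= divr_ge0 // exprn_ge0.
rewrite /expR; apply: nondecreasing_cvgn_le; last exact: is_cvg_series_exp_coeff.
apply: nondecreasing_series => k _ _; by rewrite /exp_coeff /= divr_ge0 // exprn_ge0.
Qed.

End ExponentialEstimate.

Section OutOrder.
Variables (R : realType) (C : numClosedFieldType) (cc : coordinates R C).
Variable N : nat.
Hypothesis N_gt0 : (0 < N)%N.
Local Notation mkc := (complex_of cc).
Local Notation re := (re_of cc).

Lemma mkc_real t : mkc t 0 \is Num.real.
Proof. by rewrite realE -(mkc00 cc) !le_mkc !eqxx /= le_total. Qed.

(** exp(tX) lies in G for small t.  It is not in U(N) tau, all of whose elements
    have a zero at the diagonal position o, while exp(tX) is near 1.  So exp(tX)
    is block diagonal, and its zero entry (p, q) equals t X p q up to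
    O(t^2). *)
Lemma lie_Uext_offdiag (X : 'M[C]_(N + N)) (p q : 'I_(N + N)) :
  lie (Uext N) X -> (forall A : 'M[C]_N, iota A p q = 0) -> X p q = 0.
Proof.
move=> LX off; have [c cP] := mexp_estimate cc X.
pose o := lshift N (Ordinal N_gt0); pose x0 := re `|X o o|; pose x := re `|X p q|.
have x00 : 0 <= x0 by rewrite -(le_mkc0 cc) mkc00 -norm_re.
apply/eqP; rewrite -normr_eq0 (norm_re cc) -/x; case: (ltgtP x 0) => [|x_gt0|->].
- by rewrite ltNge -(le_mkc0 cc) mkc00 -norm_re normr_ge0.
- exfalso; pose D := x0 + `|c| + 1.
  have D0 : 0 < D by rewrite /D ltr_wpDl // addr_ge0.
  (* With D above the constant c and above |X o o| + 1, this t satisfies both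
     t D <= 1/2, which excludes U(N) tau, and c t <= x / 2, which contradicts
     t x <= c t^2. *)
  pose t := Num.min 2^-1 (x / 2) / D.
  have m0 : 0 < Num.min 2^-1 (x / 2) by rewrite lt_min invr_gt0 ltr0n divr_gt0.
  have t0 : 0 < t by rewrite divr_gt0.
  have tD : t * D = Num.min 2^-1 (x / 2) by rewrite mulfVK // gt_eqF.
  have tD1 : t * D <= 2^-1 by rewrite tD ge_min lexx.
  have tDx : t * D <= x / 2 by rewrite tD ge_min lexx orbT.
  have cD : c <= D by rewrite /D; have := ler_norm c; lra.
  have D1 : 1 <= D by rewrite /D; have := normr_ge0 c; lra.
  have t1 : `|t| <= 1.
    by rewrite gtr0_norm //; have : t <= t * D by [rewrite ler_peMr // ltW|]; lra.
  have tc : t ^+ 2 * c <= t * (t * D).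
    by rewrite expr2 -mulrA ler_pM2l // ler_pM2l.
  have := LX _ (mkc_real t); case=> [[A uA AE]|[A uA AE]].
    have npq : (p == q) = false.
      apply/negP => /eqP pq; have := off 1%:M.
      by rewrite iota1 pq mxE eqxx => /eqP; rewrite oner_eq0.
    have ZE (Z : 'M[C]_(N + N)) : Z p q = 0 ->
        (Z - 1%:M - mkc t 0 *: X) p q = - (mkc t 0 * X p q).
      by move=> Z0; rewrite !mxE Z0 npq subr0 sub0r.
    have := cP t t1 p q; rewrite -AE ZE // normrN normrM norm_mkc0 (norm_re cc (X p q)) -/x.
    rewrite mkcM mulr0 mul0r !(subr0, addr0) mulr0 le_mkc0 gtr0_norm //.
    move=> h; have : t * x <= t * (x / 2).
      by apply: le_trans h _; apply: le_trans tc _; rewrite ler_pM2l.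
    by rewrite ler_pM2l //; lra.
  have := cP t t1 o o; rewrite -AE.
  have -> : (iota A *m tau C N - 1%:M - mkc t 0 *: X) o o = - (1 + mkc t 0 * X o o).
    rewrite /Defs.iota /tau mulmx_block !mulmx0 !mul0mx !addr0 !mxE.
    rewrite /o (unsplitK (inl _)) !mxE (unsplitK (inl _)) mxE eqxx mulr1n; ring.
  rewrite normrN => h.
  have : (1 : C) <= `|1 + mkc t 0 * X o o| + `|mkc t 0 * X o o|.
    rewrite -{1}(normr1 C) -{1}[1](addrK (mkc t 0 * X o o)); exact: ler_normB.
  have := h; rewrite normrM norm_mkc0 (norm_re cc (X o o)) (norm_re cc (1 + _)) -/x0 le_mkc0.
  rewrite mkcM mulr0 mul0r !(subr0, addr0) mulr0 mkcD addr0 -(mkc10 cc) le_mkc0 (gtr0_norm t0).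
  set y := re _ => hy h1.
  have : t * x0 <= t * D by rewrite ler_pM2l // /D; have := normr_ge0 c; lra.
  have : t * (t * D) <= t * 2^-1 by rewrite ler_pM2l.
  have : t <= t * D by rewrite ler_peMr // ltW.
  have : t * x0 + t ^+ 2 * c <= t * D.
    rewrite (le_trans (_ : _ <= t * (x0 + `|c|))) //; last by rewrite ler_pM2l // /D; lra.
    rewrite mulrDr lerD2l expr2 -mulrA ler_pM2l //.
    apply: le_trans (_ : t * `|c| <= _); first by rewrite ler_pM2l // ler_norm.
    by rewrite ler_piMl //; move: t1; rewrite gtr0_norm.
  lra.
- by rewrite mkc00.
Qed.

(** The generator i I of the centre of u(N), seen in Lie(G). *)
Definition central_direction : 'M[C]_(N + N) := iota (mkc 0 1)%:M.

Lemma lie_Uext_comm (X : 'M[C]_(N + N)) : lie (Uext N) X -> lieb X central_direction = 0.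
Proof.
move=> LX; have off := lie_Uext_offdiag LX.
rewrite -[X]submxK.
have -> : ursubmx X = 0.
  apply/matrixP => i j; rewrite !mxE; apply: off => A.
  by rewrite /Defs.iota block_mxEur mxE.
have -> : dlsubmx X = 0.
  apply/matrixP => i j; rewrite !mxE; apply: off => A.
  by rewrite /Defs.iota block_mxEdl mxE.
rewrite /lieb /central_direction /Defs.iota map_scalar_mx !mulmx_block.
rewrite !mulmx0 !mul0mx !addr0 !add0r.
by rewrite !scalar_mxC subrr.
Qed.

Lemma central_direction_lie : lie (Uext N) central_direction.
Proof.
have := @lie_iota_diag R C cc N 1%:M (const_mx 1).
rewrite invmx1 mul1mx mulmx1 /central_direction.
have -> : \row_i mkc 0 ((const_mx 1 : 'rV[R]_N) 0 i) = const_mx (mkc 0 1).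
  by apply/rowP => i; rewrite !mxE.
rewrite diag_const_mx; apply.
by have [] := subgroupU C N.
Qed.

Lemma lie0 : lie (Uext N) (0 : 'M[C]_(N + N)).
Proof.
have := @lie_iota_diag R C cc N 1%:M 0.
rewrite invmx1 mul1mx mulmx1.
have -> : \row_i mkc 0 ((0 : 'rV[R]_N) 0 i) = 0.
  by apply/rowP => i; rewrite !mxE mkc00.
rewrite linear0; have -> : iota (0 : 'M[C]_N) = 0 by rewrite /Defs.iota map_mx0 block_mx0.
by apply; have [] := subgroupU C N.
Qed.

Lemma lie_clie (X : 'M[C]_(N + N)) : lie (Uext N) X -> clie (Uext N) X.
Proof. by move=> LX; exists X => //; exists 0; [apply: lie0|rewrite scaler0 addr0]. Qed.

Lemma clie_comm (X : 'M[C]_(N + N)) : clie (Uext N) X -> lieb X central_direction = 0.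
Proof.
case=> A LA [B LB <-].
have := lie_Uext_comm LA; have := lie_Uext_comm LB; rewrite /lieb.
rewrite mulmxDl mulmxDr -scalemxAl -scalemxAr opprD addrACA => eB ->.
by rewrite -scalerBr eB scaler0 addr0.
Qed.

(** Lie(G) is block diagonal, so central_direction is central in it and is fixed
    by every exp(ad X); but Ad(g) replaces it by its opposite. *)
Lemma Utau_notin_Int g : @Utau C N g -> ~ Int_clie (Uext N) (conjm g).
Proof.
move=> gU [s sP /(_ _ (lie_clie central_direction_lie))].
have -> : foldr (@exp_ad C (N + N)) central_direction s = central_direction.
  elim: s sP => //= X s IH sP; rewrite IH; last by move=> Z Zs; apply: sP; rewrite inE Zs orbT.
  by apply: exp_ad_fixed; apply: clie_comm; apply: sP; rewrite inE eqxx.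
rewrite /conjm /central_direction Utau_scalar // mulmxK ?Utau_unit // => /(@iota_inj C N)/matrixP.
move=> /(_ (Ordinal N_gt0) (Ordinal N_gt0)); rewrite !mxE eqxx !mulr1n conj_mkc.
move=> /(congr1 (im_of cc)); rewrite !im_mkc; lra.
Qed.

Lemma Utau_sq g : @Utau C N g -> exists2 B, B \is unitarymx & g *m g = iota B.
Proof.
case=> A uA <-; exists (A *m map_mx Num.conj A).
  by rewrite mul_unitarymx // conjC_unitary.
by rewrite mulmxA iota_tau -mulmxA tau_sq mulmx1.
Qed.

(** g^2 lies in U(N), so Ad(g^2) = exp(ad X) for a logarithm X of g^2. *)
Lemma Out_order_Utau g : @Utau C N g -> Out_order (Uext N) g 2.
Proof.
move=> gU; split=> //.
  have [B uB gB] := Utau_sq gU.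
  have [P uP [t BE]] := unitary_diag cc uB.
  exists [:: iota (invmx P *m diag_mx (\row_i mkc 0 (t 0 i)) *m P)].
    by move=> X; rewrite inE => /eqP->; apply: lie_clie; apply: lie_iota_diag.
  move=> Y _ /=; rewrite exp_ad_iota // -BE -gB /conjm.
  by rewrite invmxM ?Utau_unit // !mulmxA.
move=> k /andP[k0 k2]; have -> : k = 1%N by case: k k0 k2 => // -[].
exact: Utau_notin_Int.
Qed.

(** The powers of an element of iota U(N) stay in iota U(N), the identity
    component, and miss tau. *)
Lemma generator_Utau g0 : generates_components (Uext N) g0 -> @Utau C N g0.
Proof.
move=> [[[A uA AE]|//] gen]; exfalso.
have sU := subgroupU C N.
have [k [_ /= -> [y]]] := gen _ (or_intror (Utau_tau C N)).
rewrite Uext_ext idcomp_ext //; [|exact: connected_U cc N|exact: Utau_tau].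
move=> [Y uY <-].
have -> : g0 ^+ k = iota (A ^+ k).
  rewrite -AE; elim: k => [|k IH]; first by rewrite !expr0 iota1.
  by rewrite !exprS -!mulmxE IH iotaM.
rewrite -iotaM => e; apply: (@iota_not_ext C N N_gt0 (A ^+ k *m Y) 1%:M (tau C N)).
- rewrite unitmx_mul (unitarymx_unit uY) andbT.
  elim: k {e} => [|k IH]; first by rewrite expr0 unitmx1.
  by rewrite exprS -mulmxE unitmx_mul (unitarymx_unit uA).
- exact: Utau_tau.
- by rewrite iota1 mul1mx.
Qed.

Lemma Utau_mod_idcomp g0 h : @Utau C N g0 -> Utau h ->
  prodset [set g0] (idcomp (Uext N)) h.
Proof.
move=> gU hU; exists g0 => //; exists (invmx g0 *m h); last by rewrite mulKVmx // Utau_unit.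
rewrite Uext_ext idcomp_ext //; [|exact: subgroupU|exact: connected_U cc N|exact: Utau_tau].
case: gU hU => A uA <- [B uB <-]; exists (map_mx Num.conj (invmx A *m B)).
  rewrite /U /= conjC_unitary; apply: mul_unitarymx => //.
  by have [_ _ _] := subgroupU C N; apply.
have uAm := unitarymx_unit uA.
have ut := tau_unit C N.
rewrite invmxM ?iota_unit // -iotaV // -mulmxA (mulmxA (iota (invmx A))) -iotaM.
have -> : invmx (tau C N) = tau C N.
  by apply: (can_inj (mulmxK ut)); rewrite mulVmx // tau_sq.
rewrite mulmxA -(conj_tau (invmx A *m B)) /conjm; congr (_ *m _ *m _).
by apply: (can_inj (mulmxK ut)); rewrite mulVmx // tau_sq.
Qed.

End OutOrder.

(** * One-parameter groups as limits of powers *)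
Section ScalarLimit.
Variables (R : realType) (C : numClosedFieldType) (cc : coordinates R C).
Local Notation mkc := (complex_of cc).
Local Notation re := (re_of cc).
Local Notation cis := (cis_of cc).

Lemma cvg_slope (f : R -> R) (mu : R) : differentiable f 0 ->
  (fun h => h^-1 * (f (h * mu) - f 0)) @ 0^' --> mu * 'D_1 f 0.
Proof.
move=> df; have -> : mu * 'D_1 f 0 = 'D_mu f 0.
  by rewrite !deriveE // -[in RHS](mulr1 mu) -[_ * 1]/(mu *: 1) linearZ.
have := diff_derivable (v := mu) df; rewrite /derivable /derive.
set g := (fun h => _); set g' := (fun h => h^-1 *: _); suff -> : g = g' by [].
by apply/funext => h; rewrite /g /g' /= addr0.
Qed.

Lemma cvg_cis_slope (mu : R) :
  (fun h => mkc h^-1 0 * (cis (h * mu) - 1)) @ 0^' --> mkc 0 mu.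
Proof.
have -> : (fun h => mkc h^-1 0 * (cis (h * mu) - 1)) =
    (fun h => mkc (h^-1 * (cos (h * mu) - cos 0)) (h^-1 * (sin (h * mu) - sin 0))).
  apply/funext => h; rewrite -(cis0 cc) /cis_of mkcB mkcM !mul0r subr0 addr0 //.
apply: cvg_mkc.
  have := @cvg_slope cos mu; rewrite (derive_val (df := - sin 0)) sin0 oppr0 mulr0.
  by apply; apply/derivable1_diffP; apply: derivable_cos.
have := @cvg_slope sin mu; rewrite (derive_val (df := cos 0)) cos0 mulr1.
by apply; apply/derivable1_diffP; apply: derivable_sin.
Qed.

Lemma mx_entry_norm m n (X : 'M[C]_(m, n)) i j : `|X i j| <= `|X|.
Proof.
rewrite [leRHS]/Num.norm /= mx_normE -[leLHS]nngE num_le.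
exact: (le_bigmax _ (fun p : 'I_m * 'I_n => `|X p.1 p.2|%:nng) (i, j)).
Qed.

Lemma unitary_expr n (X : 'M[C]_n) k : X \is unitarymx -> X ^+ k \is unitarymx.
Proof.
move=> uX; elim: k => [|k IH]; last by rewrite exprS; apply: mul_unitarymx.
by rewrite expr0; have [] := subgroupU C n.
Qed.

(** Telescoping: multiplication by the unitary k^m and by the unit w does not
    increase distances, apart from the factor n coming from the use of the
    norm of the largest entry. *)
Lemma unitary_pow_dist n (k : 'M[C]_n) (w b : C) m : k \is unitarymx -> `|w| = 1 ->
  (forall i j, `|(k - w%:M) i j| <= b) ->
  forall i j, `|(k ^+ m - (w ^+ m)%:M) i j| <= m%:R * (n%:R * b).
Proof.
move=> uk w1 hb; elim: m => [|m IH] i j.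
  by rewrite !expr0 subrr mxE normr0 mul0r.
have -> : k ^+ m.+1 - (w ^+ m.+1)%:M =
    k ^+ m *m (k - w%:M) + w *: (k ^+ m - (w ^+ m)%:M).
  rewrite exprSr exprS mulmxBr scalerBr -mulmxE mul_mx_scalar addrA subrK.
  by rewrite scale_scalar_mx.
rewrite mxE; apply: le_trans (ler_normD _ _) _.
rewrite -addn1 natrD mulrDl mul1r [leRHS]addrC lerD //; last first.
  by rewrite mxE normrM w1 mul1r.
rewrite mxE; apply: le_trans (ler_norm_sum _ _ _) _.
apply: le_trans (_ : \sum_(l < n) b <= _); last by rewrite sumr_const card_ord mulr_natl.
apply: ler_sum => l _; rewrite normrM -[leRHS]mul1r ler_pM //.
by apply: unitary_entry; apply: unitary_expr.
Qed.

(** If k tends to 1 in K with normalized difference tending to i mu, then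
    k = cis(mu |k - 1|) + o(|k - 1|).  The power of exponent
    m = floor(s / |k - 1|) is then cis(mu m |k - 1|) + m o(|k - 1|), which
    tends to cis(s mu). *)
Lemma cis_in_closed_subgroup n (K : set 'M[C]_n) (F : set_system 'M[C]_n) (mu s : R) :
  ProperFilter F -> subgroup K -> closed K -> K `<=` U n -> F K ->
  F --> (1%:M : 'M[C]_n) -> F [set k | k != 1%:M] ->
  (`|k - 1%:M|^-1 *: (k - 1%:M)) @[k --> F] --> ((mkc 0 mu)%:M : 'M[C]_n) ->
  0 <= s -> K (cis (s * mu))%:M.
Proof.
move=> PF [uK K1 KM _] cK KU FK F1 Fn1 Fu s0.
pose d (k : 'M[C]_n) := re `|k - 1%:M|.
have dE k : `|k - 1%:M| = mkc (d k) 0.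
  by apply: real_mkc; apply: ger0_real; apply: normr_ge0.
have d_gt0 : F [set k | 0 < d k].
  apply: filterS Fn1 => k /= k1; rewrite -(lt_mkc0 cc) mkc00 -dE.
  by rewrite normr_gt0 subr_eq0.
have d0 : d k @[k --> F] --> 0.
  rewrite -(re_mkc cc 0 0) mkc00 -(@normr0 C 'M[C]_n) -(subrr (1%:M : 'M[C]_n)).
  by apply: cvg_re; apply: cvg_norm; apply: cvgB => //; apply: cvg_cst.
pose m (k : 'M[C]_n) := Num.truncn (s / d k).
have mP k : 0 < d k -> s - d k <= (m k)%:R * d k <= s.
  move=> dk; have := @truncn_itv R (s / d k) (divr_ge0 s0 (ltW dk)).
  rewrite -/(m k) => /andP[h1 h2].
  move: h1 h2; rewrite ler_pdivlMr // ltr_pdivrMr // => -> h2; rewrite andbT.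
  by rewrite lerBlDr; apply: ltW; rewrite -addn1 natrD mulrDl mul1r in h2.
have md : (m k)%:R * d k @[k --> F] --> s.
  apply: (@squeeze_cvgr _ _ _ _ (fun k => s - d k) (fun=> s)).
  - by apply: filterS d_gt0 => k; apply: mP.
  - by rewrite -[X in _ --> X]subr0; apply: cvgB => //; apply: cvg_cst.
  - exact: cvg_cst.
pose w k := cis (d k * mu).
pose e k : 'M[C]_n := `|k - 1%:M|^-1 *: (k - (w k)%:M).
have e0 : e k @[k --> F] --> (0 : 'M[C]_n).
  have -> : e = (fun k => (`|k - 1%:M|^-1 *: (k - 1%:M)) -
      (mkc (d k)^-1 0 * (cis (d k * mu) - 1))%:M).
    apply/funext => k; rewrite /e.
    have -> : mkc (d k)^-1 0 = `|k - 1%:M|^-1.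
      have [dk0|dk0] := eqVneq (d k) 0; first by rewrite dE dk0 mkc00 !invr0 mkc00.
      by rewrite dE invr_mkc.
    rewrite -scale_scalar_mx -scalerBr; congr (_ *: _).
    by rewrite raddfB /= opprB addrA subrK.
  rewrite -[X in _ --> X](subrr ((mkc 0 mu)%:M : 'M[C]_n)).
  apply: cvgB => //; apply: cvg_scalar_mx.
  apply: (cvg_comp d (fun h => mkc h^-1 0 * (cis (h * mu) - 1)) (G := 0^'));
    last exact: cvg_cis_slope.
  move=> A A0; have h : F [set k | d k != 0 -> A (d k)] := d0 _ A0.
  change (F [set k | A (d k)]); apply: filterS2 d_gt0 h => k /= dk; apply.
  exact: lt0r_neq0.
have powF : ((w k) ^+ m k)%:M @[k --> F] --> ((cis (s * mu))%:M : 'M[C]_n).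
  apply: cvg_scalar_mx.
  have -> : (fun k => w k ^+ m k) = (fun k => cis ((m k)%:R * d k * mu)).
    apply/funext => k; rewrite /w -cisMn; congr cis.
    by rewrite -[RHS]mulrA mulr_natl.
  apply: (cvg_comp (fun k => (m k)%:R * d k * mu) cis); last exact: continuous_cis.
  by apply: cvgM => //; apply: cvg_cst.
have kF : k ^+ m k @[k --> F] --> ((cis (s * mu))%:M : 'M[C]_n).
  suff : (k ^+ m k - ((w k) ^+ m k)%:M) @[k --> F] --> (0 : 'M[C]_n).
    move=> h; have -> : (fun k => k ^+ m k) = (fun k : 'M[C]_n =>
        (k ^+ m k - (w k ^+ m k)%:M) + (w k ^+ m k)%:M).
      by apply/funext => k; rewrite subrK.
    by rewrite -[X in _ --> X]add0r; apply: cvgD.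
  apply: cvg_mxP => i j; rewrite mxE; apply/cvgrPdist_le => eps eps0.
  have [r r0 rE] := ltc0P cc eps0.
  pose B := n%:R * s + 1.
  have B0 : 0 < B by rewrite ltr_wpDl // mulr_ge0.
  have rB : 0 < mkc (r / B) 0 by rewrite -(mkc00 cc) lt_mkc0 divr_gt0.
  have /cvgrPdist_le/(_ _ rB) := e0.
  apply: filterS3 d_gt0 FK => k /= dk Kk; rewrite !sub0r !normrN => ek.
  have dk0 : mkc (d k) 0 != 0 by rewrite -(mkc00 cc) gt_eqF // lt_mkc0.
  have kw a b : `|(k - (w k)%:M) a b| <= mkc (d k * (r / B)) 0.
    have -> : (k - (w k)%:M) a b = mkc (d k) 0 * e k a b.
      rewrite /e dE; move: (k - (w k)%:M) => M.
      by rewrite mxE mulrA mulfV // mul1r.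
    have -> : mkc (d k * (r / B)) 0 = mkc (d k) 0 * mkc (r / B) 0.
      by rewrite mkcM !(mul0r, mulr0, subr0, addr0).
    rewrite normrM norm_mkc0 (gtr0_norm dk).
    rewrite ler_wpM2l //; first by rewrite -(mkc00 cc) le_mkc0 ltW.
    exact: le_trans (mx_entry_norm _ _ _) ek.
  have := unitary_pow_dist (m k) (KU _ Kk) (norm_cis cc _) kw i j.
  rewrite -/(w k) => /le_trans; apply.
  rewrite !(natr_mkc cc) !mkcM !(mul0r, mulr0, subr0, addr0) rE le_mkc0.
  have /andP[_ mds] := mP k dk.
  have -> : (m k)%:R * (n%:R * (d k * (r / B))) = (m k)%:R * d k * (n%:R * r / B) by ring.
  apply: le_trans (_ : s * (n%:R * r / B) <= _).
    by rewrite ler_wpM2r // divr_ge0 ?(ltW B0) // mulr_ge0 // ltW.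
  rewrite mulrA ler_pdivrMr // /B mulrDr mulr1 mulrCA mulrA.
  have -> : n%:R * s * r = r * (n%:R * s) by ring.
  by rewrite lerDl ltW.
apply: (closed_cvg _ cK _ _ kF).
apply: filterS FK => k Kk; elim: (m k) => [|j IH]; first by rewrite expr0.
by rewrite exprS; apply: KM.
Qed.
End ScalarLimit.

(** * Connected irreducible groups that are not perfect contain the scalars *)
Section Core.
Variables (R : realType) (C : numClosedFieldType) (cc : coordinates R C).
Variable n : nat.
Local Notation mkc := (complex_of cc).
Local Notation re := (re_of cc).
Local Notation cis := (cis_of cc).
Local Notation adj X := (map_mx Num.conj (trmx X)).
Implicit Types (K : set 'M[C]_n) (X Y k : 'M[C]_n).

Definition re_trace X : R := re (\tr X).

Lemma re_scale a z : re (mkc a 0 * z) = a * re z.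
Proof. by rewrite -{1}(mkcK cc z) mkcM re_mkc mul0r subr0. Qed.

Lemma re_traceB X Y : re_trace (X - Y) = re_trace X - re_trace Y.
Proof. by rewrite /re_trace raddfB reB. Qed.

Lemma re_traceZ a X : re_trace (mkc a 0 *: X) = a * re_trace X.
Proof. by rewrite /re_trace mxtraceZ re_scale. Qed.

Lemma re_traceC X Y : re_trace (X *m Y) = re_trace (Y *m X).
Proof. by rewrite /re_trace mxtrace_mulC. Qed.

Lemma cvg_re_trace T (F : set_system T) {FF : Filter F} (f : T -> 'M[C]_n) (A : 'M[C]_n) :
  f x @[x --> F] --> A -> re_trace (f x) @[x --> F] --> re_trace A.
Proof. by move=> fA; apply: cvg_re; apply: cvg_mxtrace. Qed.

Lemma cvg_adj T (F : set_system T) {FF : Filter F} (f : T -> 'M[C]_n) (A : 'M[C]_n) :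
  f x @[x --> F] --> A -> adj (f x) @[x --> F] --> adj A.
Proof. by move=> fA; apply: cvg_conjmx; apply: cvg_trmx. Qed.

Lemma adjM X Y : adj (X *m Y) = adj Y *m adj X.
Proof. by rewrite trmx_mul map_mxM. Qed.

Lemma adjK X : adj (adj X) = X.
Proof. exact: trmxCK. Qed.

Lemma adjB X Y : adj (X - Y) = adj X - adj Y.
Proof. by rewrite raddfB /= map_mxB. Qed.

Lemma adj1 : adj (1%:M : 'M[C]_n) = 1%:M.
Proof. by rewrite trmx1 map_mx1. Qed.

Lemma U_adj k : U n k -> k *m adj k = 1%:M.
Proof. by move/unitarymxP. Qed.

Lemma U_adjV k : U n k -> adj k *m k = 1%:M.
Proof. by move=> /U_adj/mulmx1C. Qed.

Lemma tr_adj X : \tr (X *m adj X) = \sum_i \sum_j `|X i j| ^+ 2.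
Proof.
apply: eq_bigr => i _; rewrite mxE; apply: eq_bigr => j _.
by rewrite !mxE normCK.
Qed.

Lemma tr_adj_ge0 X : 0 <= \tr (X *m adj X).
Proof. by rewrite tr_adj; do 2!apply: sumr_ge0 => ? _; rewrite exprn_ge0. Qed.

Lemma re_trace_adj_eq0 X : re_trace (X *m adj X) = 0 -> X = 0.
Proof.
rewrite /re_trace => e; have := real_mkc cc (ger0_real (tr_adj_ge0 X)).
rewrite e mkc00 tr_adj => /eqP.
rewrite psumr_eq0; last by move=> i _; apply: sumr_ge0 => ? _; rewrite exprn_ge0.
move=> /allP s0; apply/matrixP => i j.
have := s0 i (mem_index_enum i); rewrite /= psumr_eq0; last by move=> ? _; rewrite exprn_ge0.
move=> /allP/(_ j (mem_index_enum j)); rewrite /= sqrf_eq0 normr_eq0 => /eqP->.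
by rewrite mxE.
Qed.

(** Being nearest to 1 in Hilbert-Schmidt norm means having the largest real
    trace. *)
Lemma unitary_dist1 k : U n k ->
  \tr ((k - 1%:M) *m adj (k - 1%:M)) = mkc (2 * (n%:R - re_trace k)) 0.
Proof.
move=> uk; rewrite adjB adj1 mulmxBl mulmxBr U_adj // mulmx1 mul1mx.
rewrite !raddfB /= mxtrace1 -map_trmx mxtrace_tr.
have -> : \tr (map_mx Num.conj k) = (\tr k)^*.
  by rewrite rmorph_sum; apply: eq_bigr => i _; rewrite mxE.
rewrite -(mkcK cc (\tr k)) conj_mkc (natr_mkc cc) !mkcN !mkcD /re_trace.
congr (complex_of cc _ _); rewrite ?re_mkc; ring.
Qed.

Lemma cvg_eq_on T (F : set_system T) {FF : Filter F} (S : topologicalType)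
    (A : set T) (f g : T -> S) (l : S) :
  F A -> (forall x, A x -> f x = g x) -> f x @[x --> F] --> l -> g x @[x --> F] --> l.
Proof.
move=> FA fg fl B /fl FB; change (F [set x | B (g x)]).
have FB' : F [set x | B (f x)] := FB.
by apply: filterS2 FA FB' => x /fg /= ->.
Qed.

Section Maximal.
Variables (K K1 : set 'M[C]_n).
Hypotheses (sK : subgroup K) (cK : closed K) (coK : connected K) (KU : K `<=` U n).
Hypotheses (s1 : subgroup K1) (c1 : closed K1) (K1K : K1 `<=` K).
Hypothesis K1nK : ~ (K `<=` K1).

(** Otherwise K1 would be a neighbourhood of 1 in K, hence open by translation,
    as well as closed in the connected group K. *)
Lemma near1_outside (V : set 'M[C]_n) : nbhs (1%:M : 'M[C]_n) V ->
  exists k, [/\ V k, K k & ~ K1 k].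
Proof.
move=> V1; apply: contrapT => nex; apply: K1nK.
have [uK K1' KM KV] := sK; have [u1 K11 KM1 KV1] := s1.
have VK k : V k -> K k -> K1 k.
  by move=> Vk Kk; apply: contrapT => nk; apply: nex; exists k.
suff <- : K1 = K by [].
apply: coK; [by exists 1%:M| |by exists K1 => //; rewrite setIidr].
exists (~` closure (K `\` K1)); first exact/closed_openC/closed_closure.
apply/seteqP; split=> X; last first.
  move=> [KX nX]; apply: contrapT => nK1; apply: nX; exact: subset_closure.
move=> K1X; split; [exact: K1K|move=> cX].
have uX := u1 _ K1X.
have VX : nbhs X [set Y | V (invmx X *m Y)].
  have : (fun Y => invmx X *m Y) @ nbhs X --> (1%:M : 'M[C]_n).
    rewrite -(mulVmx uX); apply: (@cvg_mulmx _ _ (nbhs X)); [exact: cvg_cst|exact: cvg_id].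
  exact.
have [Y [[KY nY] /VK h]] := cX _ VX.
apply: nY; rewrite -(mulKVmx uX Y); apply: KM1 => //; apply: h.
by apply: KM => //; apply/KV/K1K.
Qed.

(** The elements of K outside K1 that are nearest to 1 in their coset k K1
    (see unitary_dist1). *)
Definition maximal_in_coset : set 'M[C]_n :=
  [set k | [/\ K k, ~ K1 k & forall b, K1 b -> re_trace (k *m b) <= re_trace k]].

(** The coset of an element of K outside K1 that is close to 1 is compact, and
    its nearest element to 1 is at least as close. *)
Lemma maximal_near1 (V : set 'M[C]_n) : nbhs (1%:M : 'M[C]_n) V ->
  exists k, V k /\ maximal_in_coset k.
Proof.
move=> /nbhs_ballP[e /= e0 eV]; have [r r0 re'] := ltc0P cc e0.
have [uK K1' KM KV] := sK; have [u1 K11 KM1 KV1] := s1.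
have W1 : nbhs (1%:M : 'M[C]_n) [set k | n%:R - r ^+ 2 / 2 < re_trace k].
  have h : re_trace k @[k --> nbhs (1%:M : 'M[C]_n)] --> (n%:R : R).
    have -> : n%:R = re_trace 1%:M by rewrite /re_trace mxtrace1 (natr_mkc cc) re_mkc.
    by apply: (@cvg_re_trace _ (nbhs (1%:M : 'M[C]_n))); exact: cvg_id.
  have h' := cvgr_gt _ h (n%:R - r ^+ 2 / 2); apply: h'.
  by rewrite ltrBlDr ltrDl divr_gt0 // exprn_gt0.
have [k [/= Wk Kk nk]] := near1_outside W1.
have [|||b K1b bmax] := @compact_EVT_max _ R (fun b => re_trace (k *m b)) K1.
- by exists 1%:M.
- by apply: (compact_unitary cc) => // X /K1K/KU.
- apply: continuous_subspaceT => X; apply: (@cvg_re_trace _ (nbhs X)).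
  by apply: (@cvg_mulmx _ _ (nbhs X)); [exact: cvg_cst|exact: cvg_id].
rewrite inE in K1b; exists (k *m b); split; last first.
  split.
  - by apply: KM => //; apply: K1K.
  - move=> K1kb; apply: nk; rewrite -(mulmxK (u1 _ K1b) k).
    by apply: KM1 => //; apply: KV1.
  - by move=> b' K1b'; rewrite -mulmxA; apply: bmax; rewrite inE; apply: KM1.
have Wkb : n%:R - r ^+ 2 / 2 < re_trace (k *m b).
  by apply: lt_le_trans Wk _; rewrite -{1}(mulmx1 k); apply: bmax; rewrite inE.
have ukb : U n (k *m b) by apply: KU; apply: KM => //; apply: K1K.
apply: eV; split=> // i j; rewrite -ball_normE /= distrC.
have : `|(k *m b - 1%:M) i j| ^+ 2 < e ^+ 2.
  apply: le_lt_trans (_ : \tr ((k *m b - 1%:M) *m adj (k *m b - 1%:M)) < _).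
    rewrite tr_adj (bigD1 i) //= (bigD1 j) //= -addrA lerDl addr_ge0 //.
      by apply: sumr_ge0 => ? _; rewrite exprn_ge0.
    by do 2!apply: sumr_ge0 => ? _; rewrite exprn_ge0.
  rewrite unitary_dist1 // re' expr2 mkcM !(mulr0, mul0r, subr0, addr0) lt_mkc0.
  by rewrite -expr2; lra.
by rewrite ltr_pXn2r ?nnegrE // ?(ltW e0) // !mxE.
Qed.

Hypothesis comm1 : forall X Y, K X -> K Y -> K1 (X *m Y *m adj X *m adj Y).
Hypothesis schurK : forall M, (forall X, K X -> X *m M = M *m X) -> exists c, M = c%:M.

(** The filter F is an ultrafilter of elements of maximal_in_coset tending to 1,
    along which the normalized differences u k = (k - 1)/|k - 1| converge to
    some X by compactness.  For h in K, the commutators of h with k are in K1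
    and Y h = h X h^* - X is the limit of (h k h^* k^* - 1)/|k - 1|.
    Maximality of k0 in its coset says that Re tr(k0 (b - 1)) <= 0 for b in K1.
    Applied to those commutators and to their inverses it gives
    Re tr(k0 (Y h)) = 0 in the limit; letting k0 tend to 1 gives Re tr(Y h) = 0,
    hence Re tr(u k0 (Y h)) = 0, and in the limit Re tr(X (Y h)) = 0.  Since X and its
    conjugate h X h^* have the same norm, Y h = 0. *)
Lemma tangent_scalar : exists F : set_system 'M[C]_n, exists mu : R,
  [/\ ProperFilter F, F K & F --> (1%:M : 'M[C]_n)] /\
  [/\ F [set k | k != 1%:M], mu != 0 &
    (`|k - 1%:M|^-1 *: (k - 1%:M)) @[k --> F] --> ((mkc 0 mu)%:M : 'M[C]_n)].
Proof.
have [uK K1' KM KV] := sK; have [u1 K11 KM1 KV1] := s1.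
pose M := maximal_in_coset.
have PF0 : ProperFilter (within M (nbhs (1%:M : 'M[C]_n))).
  apply: Build_ProperFilter_ex.
  move=> A wA; have [k [kA Mk]] := maximal_near1 wA.
  by exists k; apply: kA.
have [F [UF F0F]] := ultraFilterLemma PF0; have PF := ultra_proper (UltraFilter := UF).
have FM : F M by apply: F0F; exact: withinT.
have F1 : F --> (1%:M : 'M[C]_n) by move=> A A1; apply: F0F; apply: filterS A1 => k Ak _.
have FK : F K by apply: filterS FM => k [].
have Fn1 : F [set k | k != 1%:M].
  by apply: filterS FM => k [_ nk _] /=; apply/eqP => k1; apply: nk; rewrite k1.
pose u (k : 'M[C]_n) : 'M[C]_n := `|k - 1%:M|^-1 *: (k - 1%:M).
have nu k : k != 1%:M -> `|u k| = 1.
  move=> k1; rewrite normrZ normfV normr_id mulVf //.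
  by rewrite normr_eq0 subr_eq0.
have UuF : UltraFilter (u @ F).
  split; first exact: fmap_proper_filter.
  move=> G PG FG; apply/seteqP; split=> // A GA.
  have [//|FnA] := in_ultra_setVsetC (u @^-1` A) UF.
  have GnA : G (~` A) by apply: FG.
  have /filter_ex[x []] : G (A `&` ~` A) by apply: filterI.
  by [].
have [X [_ /= uX]] : [set X : 'M[C]_n | forall i j, `|X i j| <= 1]
    `&` [set p | u @ F --> p] !=set0.
  have := @compact_unit_mx R C cc n n; rewrite compact_ultra; apply => //.
  change (F [set k | forall i j, `|u k i j| <= 1]).
  apply: filterS Fn1 => k /nu k1 i j; rewrite -[leRHS]k1; exact: mx_entry_norm.
exists F.
have X1 : `|X| = 1.
  have h1 : `|u k| @[k --> F] --> `|X| by apply: cvg_norm.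
  have h2 : `|u k| @[k --> F] --> (1 : C).
    apply: cvg_near_cst; apply: filterS Fn1 => k; exact: nu.
  exact: (cvg_unique _ h1 h2).
pose r k := re `|k - 1%:M|^-1.
have rE k : `|k - 1%:M|^-1 = mkc (r k) 0.
  by apply: real_mkc; apply: ger0_real; rewrite invr_ge0; apply: normr_ge0.
have r0 k : 0 <= r k by rewrite -(le_mkc0 cc) mkc00 -rE invr_ge0; apply: normr_ge0.
have uE k : u k = mkc (r k) 0 *: (k - 1%:M) by rewrite /u rE.
have real_adj a (Z : 'M[C]_n) : adj (mkc a 0 *: Z) = mkc a 0 *: adj Z.
  by rewrite linearZ /= map_mxZ /= conj_mkc oppr0.
have Xskew : adj X = - X.
  have h1 : adj (u k) @[k --> F] --> adj X by apply: cvg_adj.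
  have h2 : - (u k *m adj k) @[k --> F] --> - (X *m adj 1%:M).
    by apply: cvgN; apply: cvg_mulmx => //; apply: cvg_adj.
  rewrite adj1 mulmx1 in h2.
  suff h3 : adj (u k) @[k --> F] --> - X by exact: (cvg_unique _ h1 h3).
  apply: (cvg_eq_on FK _ h2) => k Kk.
  rewrite !uE real_adj -scalemxAl -scalerN; congr (_ *: _).
  by rewrite adjB adj1 mulmxBl U_adj ?mul1mx ?opprB //; apply: KU.
pose Y h := h *m X *m adj h - X.
have Ycvg h : K h -> (mkc (r k) 0 *: (h *m k *m adj h *m adj k - 1%:M)) @[k --> F] --> Y h.
  move=> Kh.
  have h2 : ((h *m u k *m adj h - u k) *m adj k) @[k --> F] --> (Y h *m adj 1%:M).
    apply: cvg_mulmx; last exact: cvg_adj.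
    apply: cvgB => //; apply: cvg_mulmx; last exact: cvg_cst.
    by apply: cvg_mulmx => //; apply: cvg_cst.
  rewrite adj1 mulmx1 in h2; apply: (cvg_eq_on FK _ h2) => k Kk.
  rewrite !uE -scalemxAr -scalemxAl -scalerBr -scalemxAl; congr (_ *: _).
  have -> : h *m (k - 1%:M) *m adj h - (k - 1%:M) = h *m k *m adj h - k.
    rewrite mulmxBr mulmx1 mulmxBl U_adj; last exact: KU.
    by rewrite opprB addrA subrK.
  by rewrite mulmxBl U_adj //; apply: KU.
have Yskew h : adj (Y h) = - Y h.
  by rewrite /Y adjB !adjM adjK Xskew !mulNmx !mulmxN mulmxA opprB opprK addrC.
have ortho_le h k0 : K h -> M k0 -> re_trace (k0 *m Y h) <= 0 /\ re_trace (k0 *m adj (Y h)) <= 0.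
  move=> Kh [Kk0 _ k0max].
  have le0 b k : K1 b -> re_trace (k0 *m (mkc (r k) 0 *: (b - 1%:M))) <= 0.
    move=> K1b; rewrite -scalemxAr re_traceZ mulr_ge0_le0 //.
    by rewrite mulmxBr mulmx1 re_traceB subr_le0; apply: k0max.
  have Fb : F [set k | K1 (h *m k *m adj h *m adj k)].
    by apply: filterS FK => k Kk; apply: comm1.
  split.
    have hc : re_trace (k0 *m (mkc (r k) 0 *: (h *m k *m adj h *m adj k - 1%:M))) @[k --> F]
        --> re_trace (k0 *m Y h).
      apply: cvg_re_trace; apply: cvg_mulmx; [exact: cvg_cst|exact: Ycvg].
    by apply: (cvgr_to_le hc); apply: filterS Fb => k; apply: le0.
  have hc : re_trace (k0 *m adj (mkc (r k) 0 *: (h *m k *m adj h *m adj k - 1%:M))) @[k --> F]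
      --> re_trace (k0 *m adj (Y h)).
    apply: cvg_re_trace; apply: cvg_mulmx; [exact: cvg_cst|apply: cvg_adj; exact: Ycvg].
  apply: (cvgr_to_le hc); apply: filterS Fb => k K1b.
  rewrite real_adj adjB adj1; apply: le0.
  have <- : invmx (h *m k *m adj h *m adj k) = adj (h *m k *m adj h *m adj k).
    by rewrite invmx_unitary //; apply/KU/K1K.
  exact: KV1.
have ortho h k0 : K h -> M k0 -> re_trace (k0 *m Y h) = 0.
  move=> Kh Mk0; have [h1 h2] := ortho_le h k0 Kh Mk0.
  apply/eqP; rewrite eq_le h1 /=; move: h2.
  rewrite Yskew mulmxN -[- _]sub0r re_traceB.
  by rewrite /re_trace mxtrace0 -(mkc00 cc) re_mkc sub0r oppr_le0.
have XY0 h : K h -> re_trace (X *m Y h) = 0.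
  move=> Kh.
  have trY : re_trace (Y h) = 0.
    have hc : re_trace (k *m Y h) @[k --> F] --> re_trace (1%:M *m Y h).
      by apply: cvg_re_trace; apply: cvg_mulmx => //; apply: cvg_cst.
    rewrite mul1mx in hc.
    suff h0 : re_trace (k *m Y h) @[k --> F] --> (0 : R) by exact: (cvg_unique _ hc h0).
    by apply: (cvg_eq_on FM _ (cvg_cst (0 : R))) => k Mk; rewrite ortho.
  have hc : re_trace (u k *m Y h) @[k --> F] --> re_trace (X *m Y h).
    by apply: cvg_re_trace; apply: cvg_mulmx => //; apply: cvg_cst.
  suff h0 : re_trace (u k *m Y h) @[k --> F] --> (0 : R) by exact: (cvg_unique _ hc h0).
  apply: (cvg_eq_on FM _ (cvg_cst (0 : R))) => k Mk.
  by rewrite uE -scalemxAl re_traceZ mulmxBl mul1mx re_traceB ortho // trY subr0 mulr0.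
(* tr(Y Y^* ) = - tr((h X h^* - X)^2) = 2 tr(X h X h^* ) - 2 tr(X^2), which is
   2 tr(X Y). *)
have Y0 h : K h -> Y h = 0.
  move=> Kh; apply: re_trace_adj_eq0; rewrite Yskew mulmxN.
  have e1 : re_trace (X *m (h *m X *m adj h)) = re_trace (X *m X).
    by have := XY0 h Kh; rewrite /Y mulmxBr re_traceB => /eqP; rewrite subr_eq0 => /eqP.
  have e2 : re_trace (h *m X *m adj h *m (h *m X *m adj h)) = re_trace (X *m X).
    have hh : adj h *m h = 1%:M by apply: U_adjV; apply: KU.
    have -> : h *m X *m adj h *m (h *m X *m adj h) = h *m (X *m X) *m adj h.
      by rewrite !mulmxA -(mulmxA _ (adj h) h) hh mulmx1.
    by rewrite re_traceC mulmxA hh mul1mx.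
  rewrite -sub0r re_traceB /Y mulmxBl !mulmxBr !re_traceB e1 e2.
  rewrite (re_traceC (h *m X *m adj h) X) e1 !subrr.
  by rewrite /re_trace mxtrace0 -(mkc00 cc) re_mkc !subr0.
have [h Kh|c Xc] := schurK (M := X).
  have := Y0 h Kh; rewrite /Y => /eqP; rewrite subr_eq0 => /eqP e.
  by rewrite -{2}e -!mulmxA U_adjV ?mulmx1 //; apply: KU.
have n0 : (0 < n)%N.
  rewrite lt0n; apply/eqP => n0; have : X = 0.
    by apply/matrixP => i; move: (ltn_ord i); rewrite {2}n0.
  by move=> X0; move: X1; rewrite X0 normr0 => /eqP; rewrite eq_sym oner_eq0.
have cskew : c^* = - c.
  have := Xskew; rewrite Xc tr_scalar_mx map_scalar_mx => /matrixP.
  by move=> /(_ (Ordinal n0) (Ordinal n0)); rewrite !mxE eqxx !mulr1n.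
have cE : c = mkc 0 (im_of cc c).
  move: cskew; rewrite -(mkcK cc c) conj_mkc mkcN => /(congr1 re).
  by rewrite !re_mkc im_mkc => h; congr (complex_of cc _ _); lra.
exists (im_of cc c); split; split=> //; last by rewrite -cE -Xc.
apply/eqP => c0; move: X1; rewrite Xc cE c0 mkc00 raddf0 normr0 => /eqP.
by rewrite eq_sym oner_eq0.
Qed.

(** Every unit scalar is cis(s mu) or its inverse, for some s >= 0. *)
Lemma unit_scalars_sub : @unit_scalars C n `<=` K.
Proof.
have [F [mu [[PF FK F1] [Fn1 mu0 Fu]]]] := tangent_scalar.
move=> _ [z /= z1 <-]; have [t zt] := cis_surj cc z1.
have main s : 0 <= s -> K (cis (s * mu))%:M.
  by move=> s0; apply: (cis_in_closed_subgroup PF).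
have [h|h] := leP 0 (t / mu).
  by have := main _ h; rewrite mulfVK // zt.
have h' : 0 <= - (t / mu) by rewrite oppr_ge0 ltW.
have := main _ h'; rewrite mulNr mulfVK // cisN -zt => Kz.
have [_ _ _ KV] := sK; have := KV _ Kz; rewrite invmx_scalar.
suff -> : (z^*)^-1 = z by [].
apply: (mulfI (_ : z^* != 0)); rewrite ?mulfV -?normr_gt0 ?norm_conjC ?z1 //.
by rewrite mulrC -normCK z1 expr1n.
Qed.

End Maximal.
End Core.

(** * Semisimplicity excludes the scalars *)
Section Semisimple.
Variables (R : realType) (C : numClosedFieldType) (cc : coordinates R C).
Variable N : nat.
Hypothesis N_gt0 : (0 < N)%N.
Local Notation mkc := (complex_of cc).
Local Notation re := (re_of cc).
Local Notation cis := (cis_of cc).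

Lemma mexp_scalar t : mexp ((mkc 0 t)%:M : 'M[C]_N) = (cis t)%:M.
Proof.
have := @mexp_diag R C cc N 1%:M (const_mx t) (unitmx1 _ _).
rewrite !invmx1 !mul1mx !mulmx1.
have -> : \row_i mkc 0 ((const_mx t : 'rV[R]_N) 0 i) = const_mx (mkc 0 t).
  by apply/rowP => i; rewrite !mxE.
have -> : \row_i cis ((const_mx t : 'rV[R]_N) 0 i) = const_mx (cis t).
  by apply/rowP => i; rewrite !mxE.
by rewrite !diag_const_mx.
Qed.

(** The imaginary scalars would form an abelian ideal of Lie(K). *)
Lemma semisimple_scalars (K : set 'M[C]_N) :
  semisimple_lie (lie K) -> ~ (@unit_scalars C N `<=` K).
Proof.
move=> ssK TK.
pose I := [set X : 'M[C]_N | exists t, X = (mkc 0 t)%:M].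
have sI : real_subspace I.
  split=> [|_ _ [s ->] [t ->]|r _ rr [t ->]].
  - by exists 0; rewrite mkc00 raddf0.
  - by exists (s + t); rewrite -raddfD /= mkcD addr0.
  - exists (re r * t); rewrite scale_scalar_mx; congr (_%:M).
    by rewrite {1}(real_mkc cc rr) mkcM !(mulr0, mul0r, subr0, addr0).
have lieI X Y : I Y -> lieb X Y = 0.
  by case=> t ->; rewrite /lieb scalar_mxC subrr.
have idI : lie_ideal (lie K) I.
  split=> // [_ [t ->] r rr|X Y _ IY]; last by rewrite lieI //; case: sI.
  rewrite scale_scalar_mx (real_mkc cc rr) mkcM !(mulr0, mul0r, subr0, addr0).
  by rewrite mexp_scalar; apply: TK; exists (cis (re r * t)) => //=; apply: norm_cis.
have solI : solvable_lie I.
  exists 1%N => X /= h; apply: (h [set 0]).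
    split=> // [_ _ -> ->|t _ _ ->]; first by rewrite addr0.
    by rewrite scaler0.
  by move=> _ [A _ [B IB <-]]; rewrite /= lieI.
have /(_ (mkc 0 1)%:M) /= := ssK I idI solI.
have I1 : I (mkc 0 1)%:M by exists 1.
move=> /(_ I1)/matrixP/(_ (Ordinal N_gt0) (Ordinal N_gt0)).
rewrite !mxE eqxx mulr1n => /(congr1 (im_of cc)); rewrite im_mkc -(mkc00 cc) im_mkc => /eqP.
by rewrite oner_eq0.
Qed.

End Semisimple.

(** * Isomorphisms between the extended groups *)
Section Restrict.
Variables (C : numClosedFieldType) (N : nat).
Hypothesis N_gt0 : (0 < N)%N.
Implicit Types (L : set 'M[C]_N) (g : 'M[C]_(N + N)).

(** This is iota^-1 f iota as soon as f maps the image of iota to itself. *)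
Definition corner (f : 'M[C]_(N + N) -> 'M[C]_(N + N)) (X : 'M[C]_N) : 'M[C]_N :=
  ulsubmx (f (iota X)).

(** A continuous morphism maps the identity component iota L into the identity
    component iota L'. *)
Lemma lie_morphism_restrict L L' g g' f :
  subgroup L -> connected L -> Utau g -> subgroup L' -> connected L' -> Utau g' ->
  subgroup (ext L' g') ->
  lie_morphism (ext L g) (ext L' g') f ->
  lie_morphism L L' (corner f) /\ forall X, L X -> f (iota X) = iota (corner f X).
Proof.
move=> sL cL gU sL' cL' gU' sH' [fH fM fc].
have [uL L1 LM _] := sL; have [_ L1' _ _] := sL'.
have iL X : L X -> ext L g (iota X) by left; exists X.
have f1 : f 1%:M = 1%:M.
  have H1 : ext L g 1%:M by rewrite -iota1; apply: iL.
  have uf : f 1%:M \in unitmx by case: sH' => + _ _ _; apply; apply: fH.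
  apply: (can_inj (mulmxK uf)); rewrite mul1mx.
  by rewrite -fM // mulmx1.
have fiota X : L X -> f (iota X) = iota (corner f X) /\ L' (corner f X).
  move=> LX; have : (f @` (iota @` L)) (f (iota X)) by exists (iota X) => //; exists X.
  have sub : f @` (iota @` L) `<=` idcomp (ext L' g').
    apply: connected_component_max.
    - by exists 1%:M => //; exists 1%:M => //; apply: iota1.
    - by move=> _ [_ [Y LY <-] <-]; apply: fH; apply: iL.
    - apply: connected_continuous_connected.
        apply: connected_continuous_connected => //.
        by apply: continuous_subspaceT; apply: continuous_iota.
      by apply: continuous_subspaceW fc => _ [Y LY <-]; apply: iL.
  move=> /sub; rewrite idcomp_ext // => -[Y LY YE].
  by rewrite /corner -YE /Defs.iota block_mxKul.
split; last by move=> X /fiota[].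
split=> [X /fiota[]//|X Y LX LY|].
  apply: (@iota_inj C N); rewrite iotaM -!(proj1 (fiota _ _)) //; last exact: LM.
  by rewrite iotaM fM //; apply: iL.
apply/subspace_continuousP => X LX.
have fX := (subspace_continuousP _ _).1 fc _ (iL _ LX).
have ci : iota Y @[Y --> within L (nbhs X)] --> within (ext L g) (nbhs (iota X)).
  move=> A wA; have h : nbhs X [set Y | ext L g (iota Y) -> A (iota Y)].
    exact: (@continuous_iota C N X _ wA).
  by change (nbhs X [set Y | L Y -> A (iota Y)]); apply: filterS h => Y h LY; apply/h/iL.
apply: (cvg_comp (fun Y => f (iota Y)) (fun Z => ulsubmx Z) (G := nbhs (f (iota X)))).
  exact: (cvg_comp _ _ ci fX).
exact: continuous_ulsubmx.
Qed.

Lemma corner_cancel L L' g g' f f' :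
  subgroup L -> connected L -> Utau g -> subgroup L' -> connected L' -> Utau g' ->
  subgroup (ext L g) -> subgroup (ext L' g') ->
  lie_morphism (ext L g) (ext L' g') f -> lie_morphism (ext L' g') (ext L g) f' ->
  (forall X, ext L g X -> f' (f X) = X) ->
  forall X, L X -> corner f' (corner f X) = X.
Proof.
move=> sL cL gU sL' cL' gU' sH sH' mf mf' fK X LX.
have [[fL _ _] fE] := lie_morphism_restrict sL cL gU sL' cL' gU' sH' mf.
have [_ fE'] := lie_morphism_restrict sL' cL' gU' sL cL gU sH mf'.
apply: (@iota_inj C N); rewrite -fE' -?fE ?fK //; last exact: fL.
by left; exists X.
Qed.

Lemma morphism1 m n (H : set 'M[C]_m) (H' : set 'M[C]_n) p :
  subgroup H -> subgroup H' -> lie_morphism H H' p -> p 1%:M = 1%:M.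
Proof.
move=> [_ H1 _ _] [u' _ _ _] [pH pM _].
have uf : p 1%:M \in unitmx by apply: u'; apply: pH.
apply: (can_inj (mulmxK uf)); rewrite mul1mx.
by rewrite -pM // mulmx1.
Qed.

Lemma morphismV m n (H : set 'M[C]_m) (H' : set 'M[C]_n) p X :
  subgroup H -> subgroup H' -> lie_morphism H H' p -> H X -> p (invmx X) = invmx (p X).
Proof.
move=> sH sH' mp HX; have [pH pM _] := mp.
have [uH _ _ HV] := sH; have [u' _ _ _] := sH'.
have uf : p X \in unitmx by apply: u'; apply: pH.
apply: (can_inj (mulmxK uf)); rewrite mulVmx // -pM //; last exact: HV.
by rewrite mulVmx ?(morphism1 sH sH' mp) //; apply: uH.
Qed.

End Restrict.

Section NonIsomorphic.
Variables (R : realType) (C : numClosedFieldType) (cc : coordinates R C).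
Variables (N : nat) (K : set 'M[C]_N).
Hypotheses (sK : subgroup K) (cK : closed K) (coK : connected K) (KU : K `<=` U N).
Hypotheses (irr : irreducible_rep K id) (nT : ~ (@unit_scalars C N `<=` K)).
Hypothesis KN1 : K (- 1%:M).
Local Notation re := (re_of cc).

Let N_gt0 : (0 < N)%N. Proof. by case: irr. Qed.

Lemma commutant_unit_scalars X :
  U N X -> (forall k, K k -> k *m X = X *m k) -> @unit_scalars C N X.
Proof.
move=> uX cX; have [c Xc] := schur irr cX; exists c => //=.
by apply: (unitary_scalar N_gt0); rewrite -Xc.
Qed.

Lemma connected_unit_scalars : connected (@unit_scalars C N).
Proof.
have -> : @unit_scalars C N = range (fun t => (cis_of cc t)%:M).
  apply/seteqP; split=> [_ [z /= z1 <-]|_ [t _ <-]].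
    by have [t ->] := cis_surj cc z1; exists t.
  by exists (cis_of cc t) => //=; apply: norm_cis.
apply: connected_continuous_connected; first by apply/connected_intervalP.
by apply: continuous_subspaceT => t; apply: (@cvg_scalar_mx _ _ (nbhs t)); apply: continuous_cis.
Qed.

(** The centre of KT is T, and that of K is K n T; p' identifies them, so K n T
    is connected.  Containing I and -I, it has elements of every real part
    between -1 and 1; as the real part determines a unit scalar up to
    inversion, K n T would be all of T. *)
Lemma not_iso_with_scalars p p' :
  lie_morphism K (with_scalars K) p -> lie_morphism (with_scalars K) K p' ->
  (forall X, K X -> p' (p X) = X) -> (forall X, with_scalars K X -> p (p' X) = X) -> False.
Proof.
move=> mp mp' pK pK'; have sKT := subgroup_with_scalars sK.
have [pH pM _] := mp; have [pH' pM' pc'] := mp'.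
have KTU := with_scalars_U KU; have [_ K1 _ KV] := sK.
have TKT := unit_scalars_with_scalars K1.
have p'T z : @unit_scalars C N z -> K (p' z) /\ @unit_scalars C N (p' z).
  move=> Tz; have Kz := pH' _ (TKT _ Tz); split=> //.
  apply: commutant_unit_scalars; first exact: KU.
  move=> k Kk; have pk := pH _ Kk; have KTz := TKT _ Tz.
  by rewrite -(pK _ Kk) -(pM' _ _ pk KTz) -(pM' _ _ KTz pk) (unit_scalarsC _ Tz).
have T_image w : K w -> @unit_scalars C N w -> exists2 z, @unit_scalars C N z & p' z = w.
  move=> Kw Tw; exists (p w); last exact: pK.
  apply: commutant_unit_scalars; first by apply/KTU/pH.
  move=> k Kk; have KTk := sub_with_scalars Kk; have pk := pH' _ KTk.
  by rewrite -(pK' _ KTk) -(pM _ _ pk Kw) -(pM _ _ Kw pk) (unit_scalarsC _ Tw).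
apply: nT => _ [z /= z1 <-].
pose h (X : 'M[C]_N) : R := re (X (Ordinal N_gt0) (Ordinal N_gt0)).
have conn : connected (h @` (p' @` (@unit_scalars C N))).
  apply: connected_continuous_connected.
    apply: connected_continuous_connected; first exact: connected_unit_scalars.
    by apply: continuous_subspaceW pc'; apply: TKT.
  apply: continuous_subspaceT => X; apply: (@cvg_re _ _ _ _ (nbhs X)).
  exact: coord_continuous.
have imP c : (K c%:M /\ `|c| = 1) -> (h @` (p' @` (@unit_scalars C N))) (re c).
  move=> [Kc c1]; exists c%:M; last by rewrite /h !mxE eqxx mulr1n.
  by have [|y Ty <-] := T_image c%:M Kc; [exists c|exists y].
have : (h @` (p' @` (@unit_scalars C N))) (re z).
  move/connected_intervalP: conn; apply; [apply: (imP (-1))|apply: (imP 1)|].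
  - by rewrite normrN normr1 raddfN.
  - by rewrite normr1.
  - rewrite -(mkc10 cc) mkcN !re_mkc -ler_norml -(le_mkc0 cc) mkc10 -z1.
    exact: re_le_norm.
move=> [_ [y Ty <-]]; have [Ky [w /= w1 wE]] := p'T _ Ty.
rewrite -wE /h mxE eqxx mulr1n => rwz.
have [s sE] := cis_surj cc z1; have [t tE] := cis_surj cc w1.
have Kw : K w%:M by rewrite wE.
have iw : invmx (w%:M : 'M[C]_N) = (w^*)%:M.
  rewrite invmx_scalar; congr (_%:M); have w0 : w != 0 by rewrite -normr_gt0 w1.
  by apply: (mulfI w0); rewrite mulfV // -normCK w1 expr1n.
have : (im_of cc z) ^+ 2 = (im_of cc w) ^+ 2.
  by move: rwz; rewrite sE tE /cis_of !re_mkc !im_mkc !sin2cos2 => ->.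
move=> /eqP; rewrite eqf_sqr => /orP[]/eqP e.
  by rewrite -(mkcK cc z) e -rwz mkcK.
rewrite -(mkcK cc z) e -rwz -conj_mkc mkcK -iw; exact: KV.
Qed.

Lemma ext_not_iso_with_scalars g g' :
  Utau g -> Utau g' -> subgroup (ext K g) -> subgroup (ext (with_scalars K) g') ->
  ~ isomorphic (ext K g) (ext (with_scalars K) g').
Proof.
move=> gU gU' sH sH' [f [mf [f' [mf' fK fK']]]].
have sKT := subgroup_with_scalars sK; have coKT := connected_with_scalars cc sK coK.
have [m1 _] := lie_morphism_restrict N_gt0 sK coK gU sKT coKT gU' sH' mf.
have [m2 _] := lie_morphism_restrict N_gt0 sKT coKT gU' sK coK gU sH mf'.
apply: (not_iso_with_scalars m1 m2).
  by apply: (corner_cancel N_gt0 sK coK gU sKT coKT gU').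
by apply: (corner_cancel N_gt0 sKT coKT gU' sK coK gU).
Qed.

(** K1 = {X in K | p X in K} contains the commutators of K: if p X = k z and
    p Y = l w with k, l in K and scalars z, w, the scalars cancel in the
    commutator of p X and p Y.  If K1 were proper, unit_scalars_sub would give
    T inside K. *)
Lemma with_scalars_endo p :
  lie_morphism (with_scalars K) (with_scalars K) p -> forall X, K X -> K (p X).
Proof.
move=> mp; have sKT := subgroup_with_scalars sK; have [pH pM pc] := mp.
have [uK K1 KM KV] := sK; have [uKT _ _ KTV] := sKT.
pose K1' := [set X | K X /\ K (p X)].
apply: contrapT => npK; apply: nT.
have pV X : K X -> p (invmx X) = invmx (p X).
  by move=> KX; apply: (morphismV sKT sKT mp); apply: sub_with_scalars.
apply: (@unit_scalars_sub R C cc N K K1') => //.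
- split=> [X [KX _]|| X Y [KX KpX] [KY KpY]|X [KX KpX]].
  + exact: uK.
  + by split=> //; rewrite (morphism1 sKT sKT mp).
  + by split; [apply: KM|rewrite pM; [apply: KM|apply: sub_with_scalars..]].
  + by split; [apply: KV|rewrite pV //; apply: KV].
- move=> X cX; have KX : K X.
    by apply: cK => V VX; have [Y [[KY _] VY]] := cX V VX; exists Y.
  split=> //; apply: cK => V VX.
  have := (subspace_continuousP _ _).1 pc _ (sub_with_scalars KX) _ VX.
  move=> W; have [Y [[KY KpY] WY]] := cX _ W.
  by exists (p Y); split=> //; apply: WY; apply: sub_with_scalars.
- by move=> X [].
- by move=> KK1; apply: npK => X /KK1[].
- move=> X Y KX KY.
  have iX : map_mx Num.conj X^T = invmx X by rewrite invmx_unitary //; apply: KU.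
  have iY : map_mx Num.conj Y^T = invmx Y by rewrite invmx_unitary //; apply: KU.
  rewrite iX iY; split.
    by apply: (KM); [apply: (KM); [exact: KM|exact: KV]|exact: KV].
  have h Z : K Z -> with_scalars K Z by apply: sub_with_scalars.
  have hV Z : K Z -> with_scalars K (invmx Z) by move=> KZ; apply: h; apply: KV.
  have hM A B : with_scalars K A -> with_scalars K B -> with_scalars K (A *m B).
    by case: sKT => _ _ + _; apply.
  have KXY := hM _ _ (h _ KX) (h _ KY); have KXYX := hM _ _ KXY (hV _ KX).
  rewrite (pM _ _ KXYX (hV _ KY)) (pM _ _ KXY (hV _ KX)) (pM _ _ (h _ KX) (h _ KY)) !pV //.
  have [k Kk [z Tz <-]] := pH _ (h _ KX); have [l Kl [w Tw <-]] := pH _ (h _ KY).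
  have uk := uK _ Kk; have ul := uK _ Kl.
  have -> : k *m z *m (l *m w) *m invmx (k *m z) *m invmx (l *m w) =
            k *m l *m invmx k *m invmx l.
    have [uT _ _ _] := subgroup_unit_scalars C N.
    have ukz : k *m z \in unitmx by rewrite unitmx_mul uk uT.
    have ulw : l *m w \in unitmx by rewrite unitmx_mul ul uT.
    case: Tz ukz => c /= c1 <-; case: Tw ulw => d /= d1 <-.
    rewrite !mul_mx_scalar => udl uck; rewrite !invmxZ //.
    rewrite -!(scalemxAl, scalemxAr) !scalerA.
    have c0 : c != 0 by rewrite -normr_gt0 c1.
    have d0 : d != 0 by rewrite -normr_gt0 d1.
    by rewrite (_ : _ * _ * _ * _ = 1) ?scale1r //; field; rewrite c0.
  by apply: (KM); [apply: (KM); [exact: KM|exact: KV]|exact: KV].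
- move=> M cM; exact: (schur irr).
Qed.

End NonIsomorphic.

Section Conjugate.
Variables (C : numClosedFieldType) (N : nat) (K L : set 'M[C]_N).
Hypotheses (N_gt0 : (0 < N)%N) (sK : subgroup K).
Hypotheses (sL : subgroup L) (coL : connected L) (KL : K `<=` L) (LKT : L `<=` with_scalars K).
Variables (th1 th2 : 'M[C]_N -> 'M[C]_N) (g1 g2 : 'M[C]_(N + N)).
Hypotheses (l1 : lifts K th1 g1) (l2 : lifts K th2 g2).
Hypotheses (th1K : forall X, K X -> K (th1 X)).
Hypotheses (sH1 : subgroup (ext L g1)) (sH2 : subgroup (ext L g2)).

(** f sends g1 outside iota L, to k z g2 with k in K and z a scalar.  Applying f
    to g1 X = theta_1(X) g1 gives k theta_2(p X) = p(theta_1 X) k, where p is the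
    restriction of f. *)
Lemma iso_conjugate f f' :
  lie_morphism (ext L g1) (ext L g2) f -> lie_morphism (ext L g2) (ext L g1) f' ->
  (forall X, ext L g1 X -> f' (f X) = X) -> (forall Y, ext L g2 Y -> f (f' Y) = Y) ->
  (forall X, K X -> K (corner f X)) -> (forall X, K X -> K (corner f' X)) ->
  conjugate_in_Out K th1 th2.
Proof.
move=> mf mf' fK fK' pK pK'.
have [g1U _ _] := l1; have [g2U _ _] := l2.
have [[pL pM pc] fE] := lie_morphism_restrict N_gt0 sL coL g1U sL coL g2U sH2 mf.
have [[pL' pM' pc'] fE'] := lie_morphism_restrict N_gt0 sL coL g2U sL coL g1U sH1 mf'.
have c1 := corner_cancel N_gt0 sL coL g1U sL coL g2U sH1 sH2 mf mf' fK.
have c2 := corner_cancel N_gt0 sL coL g2U sL coL g1U sH2 sH1 mf' mf fK'.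
have [uL L1 _ _] := sL; have [fH fM _] := mf.
exists (corner f).
  split; first split=> [X /pK//|X Y /KL LX /KL LY|]; [exact: pM|exact: continuous_subspaceW pc|].
  exists (corner f'); split; first split=> [X /pK'//|X Y /KL LX /KL LY|].
  - exact: pM'.
  - exact: continuous_subspaceW pc'.
  - by move=> X /KL; apply: c1.
  - by move=> X /KL; apply: c2.
have Hg1 : ext L g1 g1 by apply: ext_g.
have [Y LY YE] : exists2 Y, L Y & f g1 = iota Y *m g2.
  case: (fH _ Hg1) => [[Y LY YE]|[Y LY YE]]; last by exists Y.
  exfalso; have := fK _ Hg1; rewrite -YE fE' // -[X in _ = X]mul1mx -iota1.
  by apply: iota_not_ext => //; apply/uL/pL'.
have [k Kk [z Tz kz]] := LKT LY.
have [uK _ _ _] := sK; have [uT _ _ _] := subgroup_unit_scalars C N.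
have uk := uK _ Kk; have uz := uT _ Tz.
exists k => // X KX; have LX := KL KX.
have LtX := KL (th1K KX).
have H1 : ext L g1 (iota X) by left; exists X.
have H2 : ext L g1 (iota (th1 X)) by left; exists (th1 X).
have e : f g1 *m iota (corner f X) = iota (corner f (th1 X)) *m f g1.
  by rewrite -!fE // -!fM // (lifts_comm l1).
move: e; rewrite YE -mulmxA (lifts_comm l2 (pK _ KX)) !mulmxA -!iotaM.
move=> /(can_inj (mulmxK (Utau_unit g2U)))/(@iota_inj C N).
rewrite -kz -mulmxA (unit_scalarsC _ Tz) !mulmxA => /(can_inj (mulmxK uz)) e.
by rewrite /= /conjm e mulmxK.
Qed.

End Conjugate.

(** * The extended groups are S-subgroups *)
Section SSubgroup.
Variables (R : realType) (C : numClosedFieldType) (cc : coordinates R C).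
Variables (N : nat) (K L : set 'M[C]_N) (th : 'M[C]_N -> 'M[C]_N) (g g0 : 'M[C]_(N + N)).

(** The exponent is e = 2, and the element h0 can be taken to be g: it differs
    from g0 by an element of the connected group U(N), and its square lies in
    K. *)
Lemma S_subgroup_ext :
  irreducible_rep K id -> ~ rep_iso K id (dual_rep id) ->
  subgroup K -> K (- 1%:M) -> K `<=` L ->
  subgroup L -> closed L -> connected L -> L `<=` U N ->
  lifts K th g -> subgroup (ext L g) ->
  generates_components (Uext N) g0 -> S_subgroup (Uext N) g0 (ext L g).
Proof.
move=> irr hns sK KN1 KL sL cL coL LU gl sH gen.
have N_gt0 : (0 < N)%N by case: irr.
have [gU _ _] := gl; have g0U := generator_Utau cc N_gt0 gen.
have [_ L1 _ _] := sL.
split.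
- by split=> //; [apply: closed_ext; [exact: Utau_unit|]|apply: ext_Uext gl _ LU].
- exists 2%N, g; rewrite idcomp_ext //; split.
  + exact: (Out_order_Utau cc N_gt0 g0U).
  + exact: (Utau_mod_idcomp cc N_gt0 g0U gU).
  + exists 1%:M.
      split=> [|Y _]; last by rewrite mul1mx mulmx1.
      by have [] := subgroup_Uext C N.
    exists (g *m g); first exact: (lifts_sq sK KN1 gl KL).
    by rewrite mul1mx expr2.
  + by rewrite -[LHS](extensionE sH L1).
- apply: (centralizer_lifts _ irr gl hns) => //.
  + by move=> X /KL/LU.
  + by move=> _ [X KX <-]; left; exists X => //; apply: KL.
  + exact: ext_g.
  + exact: ext_Uext gl _ LU.
Qed.

End SSubgroup.

Theorem theorem11 (R : realType) (N : nat) (K : set 'M[R[i]]_N)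
    (theta1 theta2 : 'M[R[i]]_N -> 'M[R[i]]_N)
    (hN : (1 < N)%N)
    (hK : closed_subgroup (U N) K)
    (hKss : connected_semisimple K)
    (hKN1 : K (- 1%:M))
    (hth1 : outer_involution K theta1)
    (hth2 : outer_involution K theta2)
    (hirr : irreducible_rep K (@id 'M[R[i]]_N))
    (hnsd : ~ rep_iso K (@id 'M[R[i]]_N) (dual_rep id))
    (hdual1 : rep_iso K (id \o theta1) (dual_rep id))
    (hdual2 : rep_iso K (id \o theta2) (dual_rep id))
    (hnconj : ~ conjugate_in_Out K theta1 theta2) :
  [/\ exists g1, lifts K theta1 g1,
      exists g2, lifts K theta2 g2
    & forall g1 g2 : 'M[R[i]]_(N + N),
      lifts K theta1 g1 -> lifts K theta2 g2 ->
      let H1 := extension K g1 in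
      let H2 := extension K g2 in
      let H3 := adjoin_center H1 in
      let H4 := adjoin_center H2 in
      [/\ forall g0 : 'M[R[i]]_(N + N), generates_components (Uext N) g0 ->
            [/\ S_subgroup (Uext N) g0 H1, S_subgroup (Uext N) g0 H2,
                S_subgroup (Uext N) g0 H3 & S_subgroup (Uext N) g0 H4],
          [/\ ~ isomorphic H1 H2, ~ isomorphic H1 H3 & ~ isomorphic H1 H4],
          [/\ ~ isomorphic H2 H3, ~ isomorphic H2 H4 & ~ isomorphic H3 H4]
        & forall (n : nat) (sigma : 'M[R[i]]_(N + N) -> 'M[R[i]]_n),
            irreducible_rep (Uext N) sigma ->
            ((dimension_datum H1 sigma)%:Z - (dimension_datum H2 sigma)%:Z)
            - ((dimension_datum H3 sigma)%:Z - (dimension_datum H4 sigma)%:Z)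
            = 0]].
Proof.
have cc := complex_coordinates R.
have [sK cK KU] := hK; have [coK ssK] := hKss.
have N_gt0 : (0 < N)%N by case: hirr.
have [[[t1K _ _] _] t1t1 _] := hth1; have [[[t2K _ _] _] t2t2 _] := hth2.
have nT := semisimple_scalars cc N_gt0 ssK.
have sKT := subgroup_with_scalars sK; have coKT := connected_with_scalars cc sK coK.
have cKT := closed_with_scalars cc cK KU; have KTU := with_scalars_U KU.
split; [exact: (lifts_exist KU hirr t1K t1t1 hdual1)
       |exact: (lifts_exist KU hirr t2K t2t2 hdual2)|].
move=> g1 g2 l1 l2 H1 H2 H3 H4.
have [g1U _ _] := l1; have [g2U _ _] := l2.
have s1 := subgroup_ext_lift sK t1K hKN1 l1.
have s2 := subgroup_ext_lift sK t2K hKN1 l2.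
have s3 := subgroup_ext_with_scalars sK t1K hKN1 l1.
have s4 := subgroup_ext_with_scalars sK t2K hKN1 l2.
have -> : H3 = ext (with_scalars K) g1 by exact: (adjoin_centerE sK KU hirr t1K hKN1 l1).
have -> : H4 = ext (with_scalars K) g2 by exact: (adjoin_centerE sK KU hirr t2K hKN1 l2).
have -> : H1 = ext K g1 by exact: (extension_lift sK t1K hKN1 l1).
have -> : H2 = ext K g2 by exact: (extension_lift sK t2K hKN1 l2).
have KK : K `<=` K by [].
have KKT := @sub_with_scalars _ _ K.
have niso := ext_not_iso_with_scalars cc sK coK KU hirr nT hKN1.
split.
- move=> g0 gen; split.
  + exact: (S_subgroup_ext cc hirr hnsd sK hKN1 KK sK cK coK KU l1 s1 gen).
  + exact: (S_subgroup_ext cc hirr hnsd sK hKN1 KK sK cK coK KU l2 s2 gen).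
  + exact: (S_subgroup_ext cc hirr hnsd sK hKN1 KKT sKT cKT coKT KTU l1 s3 gen).
  + exact: (S_subgroup_ext cc hirr hnsd sK hKN1 KKT sKT cKT coKT KTU l2 s4 gen).
- split; [|exact: niso|exact: niso].
  move=> [f [mf [f' [mf' fK fK']]]]; apply: hnconj.
  have [[pK _ _] _] := lie_morphism_restrict N_gt0 sK coK g1U sK coK g2U s2 mf.
  have [[pK' _ _] _] := lie_morphism_restrict N_gt0 sK coK g2U sK coK g1U s1 mf'.
  exact: (iso_conjugate N_gt0 sK sK coK KK KKT l1 l2 t1K s1 s2 mf mf' fK fK' pK pK').
- split; [exact: niso|exact: niso|].
  move=> [f [mf [f' [mf' fK fK']]]]; apply: hnconj.
  have [mp _] := lie_morphism_restrict N_gt0 sKT coKT g1U sKT coKT g2U s4 mf.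
  have [mp' _] := lie_morphism_restrict N_gt0 sKT coKT g2U sKT coKT g1U s3 mf'.
  have pK := with_scalars_endo cc sK cK coK KU hirr nT mp.
  have pK' := with_scalars_endo cc sK cK coK KU hirr nT mp'.
  exact: (iso_conjugate N_gt0 sK sKT coKT KKT _ l1 l2 t1K s3 s4 mf mf' fK fK' pK pK').
- move=> n sigma irrs.
  exact: (dimension_datum_combination sK KU hKN1 irrs l1 l2 t1K t1t1 t2K t2t2).
Qed.
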